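(* Let $\mathcal{L}$ be a finite distributive lattice and $\mathcal{D}$ a triangulated category with a strict admissible $\mathcal{L}$-filtration $I\mapsto \mathcal{D}_I$. Suppose given a $t$-structure on $\mathcal{D}^o_s$ for every join-prime element $s$ of $\mathcal{L}$. Then there exists a unique system of $t$-structures on the categories $\mathcal{D}_{[J,L]}=\mathcal{D}_L/\mathcal{D}_J$, for all pairs $J\preceq L$ in $\mathcal{L}$, which on $\mathcal{D}_{[I_{<\{s\}},s]}=\mathcal{D}^o_s$ is the given $t$-structure for every join-prime $s$, and such that, for any $J\preceq K\preceq L$ in $\mathcal{L}$, the $t$-structure on $\mathcal{D}_{[J,L]}$ is glued, via the recollement with respect to the subcategory $\mathcal{D}_{[J,K]}\subset \mathcal{D}_{[J,L]}$, from the $t$-structures on $\mathcal{D}_{[J,K]}$ and $\mathcal{D}_{[K,L]}$.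
   Context: Subcategories of triangulated categories are full triangulated, closed under isomorphism. A subcategory $\mathcal{D}_0\subset\mathcal{D}$ is left (right) admissible if its inclusion has a left (right) adjoint, and admissible if both hold. Put $\mathcal{D}_0^\perp=\{D:\mathrm{Hom}(\mathcal{D}_0,D)=0\}$ and ${}^\perp\mathcal{D}_0=\{D:\mathrm{Hom}(D,\mathcal{D}_0)=0\}$. $\mathrm{lAdm}(\mathcal{D})$, $\mathrm{rAdm}(\mathcal{D})$, $\mathrm{Adm}(\mathcal{D})$ are the posets (by inclusion) of left admissible, right admissible, admissible subcategories. Let $\mathcal{L}$ be a finite lattice with order $\preceq$, meet $\cap$, join $\cup$, minimum $0$, maximum $1$. A right admissible $\mathcal{L}$-filtration on $\mathcal{D}$ is an order-preserving map $\mathcal{L}\to\mathrm{rAdm}(\mathcal{D})$, $I\mapsto\mathcal{D}_I$, with $\mathcal{D}_0=0$, $\mathcal{D}_1=\mathcal{D}$, and for all $I,J$: $\mathcal{D}_{I\cap J}=\mathcal{D}_I\cap\mathcal{D}_J$ and $\mathcal{D}_{I\cup J}^\perp=\mathcal{D}_I^\perp\cap\mathcal{D}_J^\perp$. A left admissible $\mathcal{L}$-filtration is an order-preserving map $\mathcal{L}\to\mathrm{lAdm}(\mathcal{D})$ with $\mathcal{D}_0=0$, $\mathcal{D}_1=\mathcal{D}$, $\mathcal{D}_{I\cap J}=\mathcal{D}_I\cap\mathcal{D}_J$ and ${}^\perp\mathcal{D}_{I\cup J}={}^\perp\mathcal{D}_I\cap{}^\perp\mathcal{D}_J$. An admissible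 $\mathcal{L}$-filtration is a map $\mathcal{L}\to\mathrm{Adm}(\mathcal{D})$ that is both. A (left, right) admissible filtration is strict if for all $I,J$, $\mathrm{Hom}(\mathcal{D}_I/\mathcal{D}_{I\cap J},\mathcal{D}_J/\mathcal{D}_{I\cap J})=0$ in the Verdier quotient $\mathcal{D}_{I\cup J}/\mathcal{D}_{I\cap J}$. For $J\preceq K\preceq L$ the induced functor embeds $\mathcal{D}_{[J,K]}:=\mathcal{D}_K/\mathcal{D}_J$ as an admissible subcategory of $\mathcal{D}_{[J,L]}:=\mathcal{D}_L/\mathcal{D}_J$, with quotient $\mathcal{D}_{[K,L]}$. A nonzero element $s\in\mathcal{L}$ is join-prime if $s\preceq J_1\cup J_2$ implies $s\preceq J_1$ or $s\preceq J_2$. For join-prime $s$, $I_{<\{s\}}$ is the join of all join-prime elements strictly smaller than $s$, and $\mathcal{D}^o_s:=\mathcal{D}_s/\mathcal{D}_{I_{<\{s\}}}$. The recollement with respect to an admissible $\mathcal{D}_0\subset\mathcal{D}$ consists of the inclusion $i_*$ with left and right adjoints $i^*,i^!$, and the quotient functor $j^*:\mathcal{D}\to\mathcal{D}_1=\mathcal{D}/\mathcal{D}_0$ with its (fully faithful) left and right adjoints $j_!,j_*$. Given $t$-structures on $\mathcal{D}_0,\mathcal{D}_1$, the glued $t$-structure on $\mathcal{D}$ is the unique one for which $i_*$ and $j^*$ are $t$-exact: $\mathcal{D}^{\le 0}=\{D: j^*D\in\mathcal{D}_1^{\le0}, i^*D\in\mathcal{D}_0^{\le0}\}$, $\mathcal{D}^{\ge1}=\{D: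 j^*D\in\mathcal{D}_1^{\ge1}, i^!D\in\mathcal{D}_0^{\ge1}\}$. *)

(* Defs.v *)
From HB Require Import structures.
From mathcomp Require Import all_boot all_order all_algebra.
From mathcomp Require Import boolp.

Set Implicit Arguments.
Unset Strict Implicit.
Unset Printing Implicit Defensive.

Import Order.TTheory GRing.Theory.

Local Open Scope ring_scope.
Local Open Scope order_scope.
Local Open Scope quotient_scope.

Record category := Category {
  Ob :> Type;
  Hom : Ob -> Ob -> Type;
  idm : forall X, Hom X X;
  comp : forall X Y Z, Hom Y Z -> Hom X Y -> Hom X Z;
  compA : forall X Y Z W (h : Hom Z W) (g : Hom Y Z) (f : Hom X Y),
    comp h (comp g f) = comp (comp h g) f;
  compIm : forall X Y (f : Hom X Y), comp (idm Y) f = f;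
  compmI : forall X Y (f : Hom X Y), comp f (idm X) = f }.

Arguments idm {c} X.

Declare Scope cat_scope.
Delimit Scope cat_scope with cat.
Local Open Scope cat_scope.
Notation "g '∘' f" := (comp g f) (at level 40, left associativity) : cat_scope.

Record functor (C C' : category) := Functor {
  fobj :> C -> C';
  fmap : forall X Y : C, Hom X Y -> Hom (fobj X) (fobj Y);
  fmap_id : forall X, fmap (idm X) = idm (fobj X);
  fmap_comp : forall X Y Z (g : Hom Y Z) (f : Hom X Y),
    fmap (g ∘ f) = fmap g ∘ fmap f }.

Definition is_iso (C : category) (X Y : C) (f : Hom X Y) : Prop :=
  exists g : Hom Y X, g ∘ f = idm X /\ f ∘ g = idm Y.

Definition isomorphic (C : category) (X Y : C) : Prop :=
  exists f : Hom X Y, is_iso f.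

Definition zero_object (C : category) (X : C) : Prop :=
  forall Y : C, (exists! f : Hom X Y, True) /\ (exists! f : Hom Y X, True).

(* In an additive category this says that the group Hom(X, Y) is zero. *)
Definition hom0 (C : category) (X Y : C) : Prop :=
  forall f g : Hom X Y, f = g.

Definition fully_faithful (C C' : category) (F : functor C C') : Prop :=
  forall X Y : C, bijective (@fmap _ _ F X Y).

Definition ess_surj (C C' : category) (F : functor C C') : Prop :=
  forall Y : C', exists X : C, isomorphic (F X) Y.

(* F is left adjoint to G. *)
Definition adjoint (C C' : category) (F : functor C C') (G : functor C' C)
    : Prop :=
  exists phi : forall X Y, Hom (F X) Y -> Hom X (G Y),
    [/\ forall X Y, bijective (phi X Y),
        forall X X' Y (u : Hom X' X) (f : Hom (F X) Y),
          phi X' Y (f ∘ fmap F u) = phi X Y f ∘ u &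
        forall X Y Y' (v : Hom Y Y') (f : Hom (F X) Y),
          phi X Y' (v ∘ f) = fmap G v ∘ phi X Y f].

(* The language of triangulated categories, without the axioms: a category with
   an endofunctor and a class of distinguished triangles. *)
Record tridata := TriData {
  tcat :> category;
  shift : functor tcat tcat;
  dist : forall X Y Z : tcat, Hom X Y -> Hom Y Z -> Hom Z (shift X) -> Prop }.

Arguments shift {t}.
Arguments dist {t X Y Z} f g h.

Record ztridata := ZTriData {
  ztri :> tridata;
  hom_zmod : forall X Y : ztri, GRing.Zmodule (Hom X Y) }.

HB.instance Definition _ (C : ztridata) (X Y : C) : GRing.Zmodule (Hom X Y) :=
  hom_zmod X Y.

Definition is_biproduct (C : ztridata) (X Y P : C) : Prop :=
  exists (i : Hom X P) (j : Hom Y P) (p : Hom P X) (q : Hom P Y),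
    [/\ p ∘ i = idm X, q ∘ j = idm Y & i ∘ p + j ∘ q = idm P]%R.

(* The shift is an autoequivalence, not necessarily an automorphism. *)
Record triangulated (C : ztridata) : Prop := Triangulated {
  compDl : forall (X Y Z : C) (g g' : Hom Y Z) (f : Hom X Y),
    ((g + g') ∘ f = g ∘ f + g' ∘ f)%R;
  compDr : forall (X Y Z : C) (g : Hom Y Z) (f f' : Hom X Y),
    (g ∘ (f + f') = g ∘ f + g ∘ f')%R;
  has_zero : exists X : C, zero_object X;
  has_biproduct : forall X Y : C, exists P, is_biproduct X Y P;
  shift_add : forall (X Y : C) (f g : Hom X Y),
    (fmap shift (f + g) = fmap shift f + fmap shift g)%R;
  shift_ff : fully_faithful (@shift C);
  shift_es : ess_surj (@shift C);
  dist_iso : forall (X Y Z X' Y' Z' : C)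
    (f : Hom X Y) (g : Hom Y Z) (h : Hom Z (shift X))
    (f' : Hom X' Y') (g' : Hom Y' Z') (h' : Hom Z' (shift X'))
    (a : Hom X X') (b : Hom Y Y') (c : Hom Z Z'),
    is_iso a -> is_iso b -> is_iso c ->
    f' ∘ a = b ∘ f -> g' ∘ b = c ∘ g -> h' ∘ c = fmap shift a ∘ h ->
    dist f g h -> dist f' g' h';
  dist_id : forall X Z : C, zero_object Z ->
    dist (idm X) (0 : Hom X Z)%R (0 : Hom Z (shift X))%R;
  dist_cone : forall (X Y : C) (f : Hom X Y),
    exists (Z : C) (g : Hom Y Z) (h : Hom Z (shift X)), dist f g h;
  dist_rot : forall (X Y Z : C)
    (f : Hom X Y) (g : Hom Y Z) (h : Hom Z (shift X)),
    dist f g h <-> dist g h (- fmap shift f)%R;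
  dist_mor : forall (X Y Z X' Y' Z' : C)
    (f : Hom X Y) (g : Hom Y Z) (h : Hom Z (shift X))
    (f' : Hom X' Y') (g' : Hom Y' Z') (h' : Hom Z' (shift X'))
    (a : Hom X X') (b : Hom Y Y'),
    dist f g h -> dist f' g' h' -> f' ∘ a = b ∘ f ->
    exists c : Hom Z Z', g' ∘ b = c ∘ g /\ h' ∘ c = fmap shift a ∘ h;
  dist_oct : forall (X Y Z A B W : C) (f : Hom X Y) (g : Hom Y Z)
    (f1 : Hom Y A) (f2 : Hom A (shift X))
    (g1 : Hom Z B) (g2 : Hom B (shift Y))
    (k1 : Hom Z W) (k2 : Hom W (shift X)),
    dist f f1 f2 -> dist g g1 g2 -> dist (g ∘ f) k1 k2 ->
    exists (u : Hom A W) (v : Hom W B),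
      [/\ dist u v (fmap shift f1 ∘ g2),
          u ∘ f1 = k1 ∘ g /\ k2 ∘ u = f2
        & v ∘ k1 = g1 /\ g2 ∘ v = fmap shift f ∘ k2] }.

Record tricat := TriCat {
  tric :> ztridata;
  tricP : triangulated tric }.

(* A strictly full triangulated subcategory, given by its objects. *)
Record subcat (D : tricat) := Subcat {
  in_sub :> D -> Prop;
  sub_iso : forall X Y : D, isomorphic X Y -> in_sub X -> in_sub Y;
  sub_zero : forall X : D, zero_object X -> in_sub X;
  sub_biproduct : forall X Y P : D,
    is_biproduct X Y P -> in_sub X -> in_sub Y -> in_sub P;
  sub_shift : forall X : D, in_sub X <-> in_sub (shift X);
  sub_cone : forall (X Y Z : D) (f : Hom X Y) (g : Hom Y Z)
    (h : Hom Z (shift X)), dist f g h -> in_sub X -> in_sub Y -> in_sub Z }.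

Definition subcat_le (D : tricat) (A B : subcat D) : Prop :=
  forall X : D, A X -> B X.

Section FullSubcategory.
Variables (D : tricat) (A : subcat D).

Definition subOb : Type := {X : D | A X}.

Definition sub_category : category := @Category subOb
  (fun X Y => Hom (sval X) (sval Y)) (fun X => idm (sval X))
  (fun X Y Z g f => g ∘ f)
  (fun X Y Z W h g f => compA h g f)
  (fun X Y f => compIm f) (fun X Y f => compmI f).

Definition sub_shift_ob (X : subOb) : subOb :=
  exist _ (shift (sval X)) (proj1 (sub_shift A (sval X)) (svalP X)).

Definition sub_shift_functor : functor sub_category sub_category :=
  @Functor sub_category sub_category sub_shift_ob
    (fun X Y f => fmap (@shift D) f)
    (fun X => fmap_id shift (sval X))
    (fun X Y Z g f => fmap_comp shift g f).

Definition sub_tridata : tridata := @TriData sub_category sub_shift_functor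
  (fun X Y Z f g h => @dist D _ _ _ f g h).

Definition sub_ztridata : ztridata := @ZTriData sub_tridata
  (fun X Y => @hom_zmod D (sval X) (sval Y)).

Lemma zero_sub (Z : sub_ztridata) :
  @zero_object sub_ztridata Z -> @zero_object D (sval Z).
Proof.
have tD := tricP D; move=> Z0.
have idZ : idm (sval Z) = 0%R :> Hom (sval Z) (sval Z).
  have [[u [_ uP]] _] := Z0 Z.
  by rewrite -(uP (idm (sval Z)) I) -(uP 0%R I).
move=> Y; split; exists 0%R; split=> // f _.
  rewrite -[f]compmI idZ; apply: (@addrI _ (f ∘ 0%R)).
  by rewrite -(compDr tD) !addr0.
rewrite -[f]compIm idZ; apply: (@addrI _ (0%R ∘ f)).
by rewrite -(compDl tD) !addr0.
Qed.

Lemma sub_triangulated : triangulated sub_ztridata.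
Proof.
have tD := tricP D.
split.
- by move=> X Y Z; apply: (compDl tD).
- by move=> X Y Z; apply: (compDr tD).
- have [Z Z0] := has_zero tD.
  by exists (exist _ Z (sub_zero A Z0)) => Y; apply: Z0.
- move=> X Y; have [P PXY] := has_biproduct tD (sval X) (sval Y).
  by exists (exist _ P (sub_biproduct PXY (svalP X) (svalP Y))).
- by move=> X Y; apply: (shift_add tD).
- by move=> X Y; apply: (shift_ff tD).
- move=> Y; have [X [f fP]] := shift_es tD (sval Y).
  suff AX : A X by exists (exist _ X AX), f.
  apply/sub_shift; apply: (sub_iso _ (svalP Y)).
  by case: fP => g [gf fg]; exists g, f.
- by move=> X Y Z X' Y' Z' f g h f' g' h' a b c; apply: (dist_iso tD).
- move=> X Z Z0; apply: (dist_id tD); exact: zero_sub Z0.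
- move=> X Y f; have [Z [g [h fgh]]] := dist_cone tD f.
  by exists (exist _ Z (sub_cone fgh (svalP X) (svalP Y))), g, h.
- by move=> X Y Z f g h; apply: (dist_rot tD).
- by move=> X Y Z X' Y' Z' f g h f' g' h' a b; apply: (dist_mor tD).
- by move=> X Y Z B C W f g f1 f2 g1 g2 k1 k2; apply: (dist_oct tD).
Qed.

Definition sub : tricat := TriCat sub_triangulated.

Definition incl : functor sub D := @Functor sub D
  (fun X => sval X) (fun X Y f => f) (fun X => erefl) (fun X Y Z g f => erefl).

End FullSubcategory.

Definition sub_incl (D : tricat) (A B : subcat D) (AB : subcat_le A B) :
    functor (sub A) (sub B) :=
  @Functor (sub A) (sub B) (fun X => exist _ (sval X) (AB _ (svalP X)))
    (fun X Y f => f) (fun X => erefl) (fun X Y Z g f => erefl).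

Definition id_functor (C : category) : functor C C :=
  @Functor C C id (fun X Y f => f) (fun X => erefl) (fun X Y Z g f => erefl).

(* The subcategory A ∩ B of A. *)
Definition restr (D : tricat) (A B : subcat D) : subcat (sub A).
Proof.
refine (@Subcat (sub A) (fun X => B (sval X)) _ _ _ _ _).
- by move=> X Y [f fP]; apply: sub_iso; exists f.
- move=> X X0; apply: sub_zero; apply/(zero_sub X0).
- by move=> X Y P PXY; apply: sub_biproduct.
- by move=> X; apply: (sub_shift B (sval X)).
- by move=> X Y Z f g h fgh; apply: (@sub_cone D B _ _ _ _ _ _ fgh).
Defined.

Section Localization.
Variables (C : category) (S : forall X Y : C, Hom X Y -> Prop).

(* A formal composite of morphisms of C and inverses of morphisms in S, the
   morphism applied first being at the head. *)
Inductive zigzag : C -> C -> Type :=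
| znil X : zigzag X X
| zfwd X Y Z : Hom X Y -> zigzag Y Z -> zigzag X Z
| zbwd X Y Z (s : Hom Y X) : S s -> zigzag Y Z -> zigzag X Z.

Inductive zeq : forall X Y, zigzag X Y -> zigzag X Y -> Prop :=
| zeq_refl X Y (p : zigzag X Y) : zeq p p
| zeq_sym X Y (p q : zigzag X Y) : zeq p q -> zeq q p
| zeq_trans X Y (q p r : zigzag X Y) : zeq p q -> zeq q r -> zeq p r
| zeq_fwd X Y Z (f : Hom X Y) (p q : zigzag Y Z) :
    zeq p q -> zeq (zfwd f p) (zfwd f q)
| zeq_bwd X Y Z (s : Hom Y X) (Ss : S s) (p q : zigzag Y Z) :
    zeq p q -> zeq (zbwd Ss p) (zbwd Ss q)
| zeq_id X Y (p : zigzag X Y) : zeq (zfwd (idm X) p) p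
| zeq_comp X Y Z W (f : Hom X Y) (g : Hom Y Z) (p : zigzag Z W) :
    zeq (zfwd f (zfwd g p)) (zfwd (g ∘ f) p)
| zeq_fwd_bwd X Y Z (s : Hom X Y) (Ss : S s) (p : zigzag X Z) :
    zeq (zfwd s (zbwd Ss p)) p
| zeq_bwd_fwd X Y Z (s : Hom Y X) (Ss : S s) (p : zigzag X Z) :
    zeq (zbwd Ss (zfwd s p)) p.

Fixpoint zcat X Y Z (p : zigzag X Y) : zigzag Y Z -> zigzag X Z :=
  match p with
  | znil _ => id
  | zfwd _ _ _ f p' => fun q => zfwd f (zcat p' q)
  | zbwd _ _ _ _ Ss p' => fun q => zbwd Ss (zcat p' q)
  end.

Lemma zcat_nil X Y (p : zigzag X Y) : zcat p (znil Y) = p.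
Proof. by elim: p => //= {}X Z W => [f|s Ss] p ->. Qed.

Lemma zcatA X Y Z W (p : zigzag X Y) (q : zigzag Y Z) (r : zigzag Z W) :
  zcat p (zcat q r) = zcat (zcat p q) r.
Proof.
by elim: p q => //= {}X V {}Y => [f|s Ss] p IHp q; rewrite IHp.
Qed.

Lemma zeq_cat X Y Z (p p' : zigzag X Y) (q q' : zigzag Y Z) :
  zeq p p' -> zeq q q' -> zeq (zcat p q) (zcat p' q').
Proof.
move=> pp' qq'; apply: (@zeq_trans _ _ (zcat p q')).
  elim: p q q' qq' {p' pp'} => //= {}X V {}Y => [f|s Ss] p IHp q q' qq'.
    exact/zeq_fwd/IHp.
  exact/zeq_bwd/IHp.
elim: pp' q' {q qq'} => {X Y p p'} /=.
- by move=> *; apply: zeq_refl.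
- by move=> X Y p q _ IH r; apply: zeq_sym.
- by move=> X Y q p r _ IH _ IH' s; apply: zeq_trans (IH s) (IH' s).
- by move=> X Y W f p q _ IH r; apply: zeq_fwd.
- by move=> X Y W s Ss p q _ IH r; apply: zeq_bwd.
- by move=> *; apply: zeq_id.
- by move=> *; apply: zeq_comp.
- by move=> *; apply: zeq_fwd_bwd.
- by move=> *; apply: zeq_bwd_fwd.
Qed.

HB.instance Definition _ X Y := gen_eqMixin (zigzag X Y).
HB.instance Definition _ X Y := gen_choiceMixin (zigzag X Y).

Definition zeqb X Y (p q : zigzag X Y) : bool := `[< zeq p q >].

Lemma zeqb_refl X Y : reflexive (@zeqb X Y).
Proof. by move=> p; apply/asboolP/zeq_refl. Qed.

Lemma zeqb_sym X Y : symmetric (@zeqb X Y).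
Proof. by move=> p q; apply/asboolP/asboolP; apply: zeq_sym. Qed.

Lemma zeqb_trans X Y : transitive (@zeqb X Y).
Proof.
move=> q p r /asboolP pq /asboolP qr; apply/asboolP; exact: zeq_trans pq qr.
Qed.

Canonical zeq_equiv X Y :=
  EquivRel (@zeqb X Y) (@zeqb_refl X Y) (@zeqb_sym X Y) (@zeqb_trans X Y).

Definition loc_hom (X Y : C) : Type := {eq_quot (zeq_equiv X Y)}.

Definition loc_class X Y (p : zigzag X Y) : loc_hom X Y :=
  \pi_{eq_quot (zeq_equiv X Y)} p.

Definition loc_repr X Y (f : loc_hom X Y) : zigzag X Y := repr f.

Lemma loc_reprK X Y (f : loc_hom X Y) : loc_class (loc_repr f) = f.
Proof. exact: reprK. Qed.

Lemma loc_classP X Y (p q : zigzag X Y) :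
  loc_class p = loc_class q <-> zeq p q.
Proof.
split=> [/eqmodP/asboolP//|pq].
by apply/eqmodP; apply/asboolP.
Qed.

Lemma zeq_repr X Y (p : zigzag X Y) : zeq (loc_repr (loc_class p)) p.
Proof. by apply/loc_classP; rewrite loc_reprK. Qed.

Definition loc_comp X Y Z (g : loc_hom Y Z) (f : loc_hom X Y) : loc_hom X Z :=
  loc_class (zcat (loc_repr f) (loc_repr g)).

Lemma loc_compE X Y Z (q : zigzag Y Z) (p : zigzag X Y) :
  loc_comp (loc_class q) (loc_class p) = loc_class (zcat p q).
Proof. by apply/loc_classP/zeq_cat; apply: zeq_repr. Qed.

Lemma loc_compA X Y Z W (h : loc_hom Z W) (g : loc_hom Y Z) (f : loc_hom X Y) :
  loc_comp h (loc_comp g f) = loc_comp (loc_comp h g) f.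
Proof.
rewrite -(loc_reprK f) -(loc_reprK g) -(loc_reprK h).
by rewrite !loc_compE zcatA.
Qed.

Lemma loc_compIm X Y (f : loc_hom X Y) : loc_comp (loc_class (znil Y)) f = f.
Proof. by rewrite -(loc_reprK f) loc_compE zcat_nil. Qed.

Lemma loc_compmI X Y (f : loc_hom X Y) : loc_comp f (loc_class (znil X)) = f.
Proof. by rewrite -(loc_reprK f) loc_compE. Qed.

(* The Gabriel-Zisman localization of C at S. *)
Definition localization : category :=
  Category loc_compA loc_compIm loc_compmI.

Definition loc_mor (X Y : C) (f : Hom X Y) : @Hom localization X Y :=
  loc_class (zfwd f (znil Y)).

Lemma loc_mor_id (X : C) : loc_mor (idm X) = @idm localization X.
Proof. exact/loc_classP/zeq_id. Qed.

Lemma loc_mor_comp (X Y Z : C) (g : Hom Y Z) (f : Hom X Y) :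
  loc_mor (g ∘ f) = loc_mor g ∘ loc_mor f.
Proof. by rewrite /= loc_compE; apply/loc_classP/zeq_sym/zeq_comp. Qed.

Definition loc_functor : functor C localization :=
  @Functor C localization id loc_mor loc_mor_id loc_mor_comp.

End Localization.

Section LocalizationMap.
Variables (C C' : category).
Variables (S : forall X Y : C, Hom X Y -> Prop).
Variables (S' : forall X Y : C', Hom X Y -> Prop).
Variables (F : functor C C').
Hypothesis FS : forall (X Y : C) (s : Hom X Y), S s -> S' (fmap F s).

Fixpoint zmap X Y (p : zigzag S X Y) : zigzag S' (F X) (F Y) :=
  match p with
  | znil X => znil S' (F X)
  | zfwd _ _ _ f p' => zfwd (fmap F f) (zmap p')
  | zbwd _ _ _ _ Ss p' => zbwd (FS Ss) (zmap p')
  end.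

Lemma zmap_zeq X Y (p q : zigzag S X Y) : zeq p q -> zeq (zmap p) (zmap q).
Proof.
elim=> {X Y p q} /=.
- by move=> *; apply: zeq_refl.
- by move=> X Y p q _; apply: zeq_sym.
- by move=> X Y q p r _ pq _; apply: zeq_trans.
- by move=> X Y Z f p q _; apply: zeq_fwd.
- by move=> X Y Z s Ss p q _; apply: zeq_bwd.
- by move=> X Y p; rewrite fmap_id; apply: zeq_id.
- by move=> X Y Z W f g p; rewrite fmap_comp; apply: zeq_comp.
- by move=> *; apply: zeq_fwd_bwd.
- by move=> *; apply: zeq_bwd_fwd.
Qed.

Lemma zmap_cat X Y Z (p : zigzag S X Y) (q : zigzag S Y Z) :
  zmap (zcat p q) = zcat (zmap p) (zmap q).
Proof. by elim: p q => //= {}X V {}Y => [f|s Ss] p IHp q; rewrite IHp. Qed.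

Definition loc_map_mor X Y (f : loc_hom S X Y) : loc_hom S' (F X) (F Y) :=
  loc_class (zmap (loc_repr f)).

Lemma loc_map_morE X Y (p : zigzag S X Y) :
  loc_map_mor (loc_class p) = loc_class (zmap p).
Proof. exact/loc_classP/zmap_zeq/zeq_repr. Qed.

Lemma loc_map_id (X : C) :
  loc_map_mor (@idm (localization S) X) = @idm (localization S') (F X).
Proof. by rewrite /= loc_map_morE. Qed.

Lemma loc_map_comp (X Y Z : localization S) (g : Hom Y Z) (f : Hom X Y) :
  loc_map_mor (g ∘ f)
    = @comp (localization S') _ _ _ (loc_map_mor g) (loc_map_mor f).
Proof.
rewrite -[in LHS](loc_reprK f) -[in LHS](loc_reprK g) /= !loc_compE.
by rewrite loc_map_morE zmap_cat.
Qed.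

Definition loc_map : functor (localization S) (localization S') :=
  @Functor (localization S) (localization S') F loc_map_mor
    loc_map_id loc_map_comp.

End LocalizationMap.

Section VerdierQuotient.
Variables (D : tricat) (N : subcat D).

Definition cone_in (X Y : D) (s : Hom X Y) : Prop :=
  exists (Z : D) (g : Hom Y Z) (h : Hom Z (shift X)), dist s g h /\ N Z.

Lemma cone_in_shift (X Y : D) (s : Hom X Y) :
  cone_in s -> cone_in (fmap shift s).
Proof.
have tD := tricP D.
case=> Z [g [h [sgh NZ]]].
exists (shift Z), (fmap shift g), (- fmap shift h)%R.
split; last exact: (proj1 (sub_shift N Z)).
have compmN (U V W : D) (f : Hom V W) (k : Hom U V) :
    (f ∘ (- k) = - (f ∘ k))%R.
  apply: (addrI (f ∘ k)); rewrite subrr -(compDr tD) subrr.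
  by apply: (addrI (f ∘ 0%R)); rewrite -(compDr tD) !addr0.
have compNm (U V W : D) (f : Hom V W) (k : Hom U V) :
    ((- f) ∘ k = - (f ∘ k))%R.
  apply: (addrI (f ∘ k)); rewrite subrr -(compDl tD) subrr.
  by apply: (addrI (0%R ∘ k)); rewrite -(compDl tD) !addr0.
have iso1 (U : D) : is_iso (idm U) by exists (idm U); rewrite compIm.
have isoN (U : D) : is_iso (- idm U)%R.
  by exists (- idm U)%R; rewrite compmN compNm opprK compIm.
move: sgh => /(dist_rot tD) /(dist_rot tD) /(dist_rot tD).
apply: (dist_iso tD (iso1 _) (isoN _) (iso1 _)).
- by rewrite compmI compNm compIm opprK.
- by rewrite compmN compmI compIm.
- by rewrite fmap_id compIm compmI.
Qed.

Definition verdier_shift :=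
  loc_map (F := @shift D) cone_in_shift.

(* A triangle of D/N is distinguished if it is isomorphic to the image of a
   distinguished triangle of D. *)
Definition verdier_dist (X Y Z : localization cone_in)
    (f : Hom X Y) (g : Hom Y Z) (h : Hom Z (verdier_shift X)) : Prop :=
  exists (X' Y' Z' : D) (f' : Hom X' Y') (g' : Hom Y' Z')
    (h' : Hom Z' (shift X')),
    dist f' g' h' /\
  exists (a : @Hom (localization cone_in) X' X)
    (b : @Hom (localization cone_in) Y' Y)
    (c : @Hom (localization cone_in) Z' Z),
    [/\ is_iso a, is_iso b & is_iso c] /\
    [/\ f ∘ a = b ∘ loc_mor cone_in f',
        g ∘ b = c ∘ loc_mor cone_in g'
      & h ∘ c = fmap verdier_shift a ∘ loc_mor cone_in h'].

(* The Verdier quotient D/N; its objects are those of D. Only the shift and the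
   distinguished triangles are recorded: the addition of morphisms is determined
   by the category. *)
Definition verdier : tridata := TriData verdier_dist.

End VerdierQuotient.

(* As the classes are closed under isomorphism and the shift is an equivalence,
   [ge1_shift] says that T^{>=1}[-1] is contained in T^{>=1}. *)
Record t_structure (T : tridata) := TStructure {
  le0 : T -> Prop;
  ge1 : T -> Prop;
  le0_iso : forall X Y : T, isomorphic X Y -> le0 X -> le0 Y;
  ge1_iso : forall X Y : T, isomorphic X Y -> ge1 X -> ge1 Y;
  le0_shift : forall X : T, le0 X -> le0 (shift X);
  ge1_shift : forall X : T, ge1 (shift X) -> ge1 X;
  t_hom0 : forall X Y : T, le0 X -> ge1 Y -> hom0 X Y;
  t_trunc : forall X : T, exists (A B : T)
    (f : Hom A X) (g : Hom X B) (h : Hom B (shift A)),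
    [/\ le0 A, ge1 B & dist f g h] }.

(* i, j stand for i_*, j^*; the fields for i^*, i^!, j_!, j_*. *)
Record recollement (T0 T T1 : category) (i : functor T0 T) (j : functor T T1) :=
  Recollement {
    i_left : functor T T0;
    i_right : functor T T0;
    j_left : functor T1 T;
    j_right : functor T1 T;
    i_left_adj : adjoint i_left i;
    i_right_adj : adjoint i i_right;
    j_left_adj : adjoint j_left j;
    j_right_adj : adjoint j j_right;
    i_ff : fully_faithful i;
    j_left_ff : fully_faithful j_left;
    j_right_ff : fully_faithful j_right }.

Definition glued (T0 T T1 : tridata) (i : functor T0 T) (j : functor T T1)
    (r : recollement i j) (t0 : t_structure T0) (t1 : t_structure T1)
    (t : t_structure T) : Prop :=
  (forall X : T, le0 t X <-> le0 t1 (j X) /\ le0 t0 (i_left r X)) /\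
  (forall X : T, ge1 t X <-> ge1 t1 (j X) /\ ge1 t0 (i_right r X)).

Definition left_admissible (D : tricat) (A : subcat D) : Prop :=
  exists G : functor D (sub A), adjoint G (incl A).

Definition right_admissible (D : tricat) (A : subcat D) : Prop :=
  exists G : functor D (sub A), adjoint (incl A) G.

Definition right_orth (D : tricat) (A : subcat D) (X : D) : Prop :=
  forall Y : D, A Y -> hom0 Y X.

Definition left_orth (D : tricat) (A : subcat D) (X : D) : Prop :=
  forall Y : D, A Y -> hom0 X Y.

Section Filtrations.
Context {disp : Order.disp_t} {L : finTBLatticeType disp} {D : tricat}.
Variable F : L -> subcat D.

Record right_admissible_filtration : Prop := RightAdmissibleFiltration {
  rfil_adm : forall I, right_admissible (F I);
  rfil_mono : forall I J, I <= J -> subcat_le (F I) (F J);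
  rfil_bot : forall X, F \bot X <-> zero_object X;
  rfil_top : forall X, F \top X;
  rfil_meet : forall I J X, F (I `&` J) X <-> F I X /\ F J X;
  rfil_join : forall I J X, right_orth (F (I `|` J)) X
    <-> right_orth (F I) X /\ right_orth (F J) X }.

Record left_admissible_filtration : Prop := LeftAdmissibleFiltration {
  lfil_adm : forall I, left_admissible (F I);
  lfil_mono : forall I J, I <= J -> subcat_le (F I) (F J);
  lfil_bot : forall X, F \bot X <-> zero_object X;
  lfil_top : forall X, F \top X;
  lfil_meet : forall I J X, F (I `&` J) X <-> F I X /\ F J X;
  lfil_join : forall I J X, left_orth (F (I `|` J)) X
    <-> left_orth (F I) X /\ left_orth (F J) X }.

Definition admissible_filtration : Prop :=
  left_admissible_filtration /\ right_admissible_filtration.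

(* F_M / F_J, meaningful for J <= M. *)
Definition fquot (J L : L) : tridata := verdier (restr (F L) (F J)).

Definition strict_filtration : Prop :=
  forall (I J : L) (X Y : fquot (I `&` J) (I `|` J)),
    F I (sval X) -> F J (sval Y) -> hom0 X Y.

Lemma cone_in_incl (J K M : L) (KL : subcat_le (F K) (F M))
    (X Y : sub (F K)) (s : Hom X Y) :
  cone_in (restr (F K) (F J)) s ->
  cone_in (restr (F M) (F J)) (fmap (sub_incl KL) s).
Proof.
by case=> Z [g [h [sgh JZ]]]; exists (sub_incl KL Z), g, h.
Qed.

(* The functor F_K / F_J -> F_M / F_J induced by the inclusion of F_K in F_M. *)
Definition fquot_incl (J K M : L) (KL : subcat_le (F K) (F M)) :
    functor (fquot J K) (fquot J M) :=
  loc_map (cone_in_incl (J := J) KL).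

Lemma cone_in_quot (J K M : L) (JK : subcat_le (F J) (F K))
    (X Y : sub (F M)) (s : Hom X Y) :
  cone_in (restr (F M) (F J)) s ->
  cone_in (restr (F M) (F K)) (fmap (id_functor (sub (F M))) s).
Proof.
by case=> Z [g [h [sgh JZ]]]; exists Z, g, h; split=> //; apply: JK.
Qed.

(* The functor F_M / F_J -> F_M / F_K induced by the identity of F_M. *)
Definition fquot_quot (J K M : L) (JK : subcat_le (F J) (F K)) :
    functor (fquot J M) (fquot K M) :=
  loc_map (cone_in_quot (M := M) JK).

End Filtrations.

Section JoinPrime.
Context {disp : Order.disp_t} {L : finTBLatticeType disp}.

Definition join_prime (s : L) : bool :=
  (s != \bot)
  && [forall J1 : L, forall J2 : L,
        (s <= J1 `|` J2) ==> ((s <= J1) || (s <= J2))].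

(* The element I_{<{s}}. *)
Definition join_lt (s : L) : L := \join_(r : L | join_prime r && (r < s)) r.

Lemma join_lt_le (s : L) : join_lt s <= s.
Proof. by apply/joinsP => r /andP[_ /ltW]. Qed.

End JoinPrime.

(* Main.v *)
(* Write s for a join-prime of L. Strictness says that an object of F_J left
   orthogonal to F_(I cap J) is left orthogonal to F_I, and dually. Let A_s be
   the objects of F_s left orthogonal to F_{<s} lying in the aisle of the
   stratum of s, and B_s those right orthogonal to F_{<s} lying in the coaisle.
   The t-structure on F_M / F_J is then given in terms of Hom in D: X is in the
   aisle when Hom(X, B_s) = 0, and in the coaisle when Hom(A_s, X) = 0, for all
   s <= M with not s <= J. For these s, B_s is right orthogonal to F_J, so that
   Hom(X, B_s) is the same in D and in F_M / F_J; the gluing property thus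
   follows from the adjunctions alone. Truncation triangles are built in D by
   induction on I, peeling off a maximal join-prime below I, and they stay in
   each F_I. Conversely, in any system glued from the given t-structures, A_s
   lies in the aisle and B_s in the coaisle, which determines the system, since
   aisle and coaisle of a t-structure are each other's orthogonals. *)

From mathcomp Require Import all_boot all_order all_algebra.
From mathcomp Require Import boolp.
Require Import Defs.

Set Implicit Arguments.
Unset Strict Implicit.
Unset Printing Implicit Defensive.

Import Order.TTheory GRing.Theory.
Local Open Scope ring_scope.
Local Open Scope order_scope.
Local Open Scope cat_scope.

(** * Triangles and admissible subcategories *)

Section Categories.
Variable C : category.

Lemma is_iso_id (X : C) : is_iso (idm X).
Proof. by exists (idm X); rewrite compIm. Qed.

Lemma is_iso_comp (X Y Z : C) (g : Hom Y Z) (f : Hom X Y) :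
  is_iso g -> is_iso f -> is_iso (g ∘ f).
Proof.
case=> g' [g'g gg'] [f' [f'f ff']]; exists (f' ∘ g'); split.
  by rewrite -compA (compA g') g'g compIm.
by rewrite -compA (compA f) ff' compIm.
Qed.

Lemma isomorphic_refl (X : C) : isomorphic X X.
Proof. by exists (idm X); apply: is_iso_id. Qed.

Lemma isomorphic_sym (X Y : C) : isomorphic X Y -> isomorphic Y X.
Proof. by case=> f [g [gf fg]]; exists g, f. Qed.

Lemma isomorphic_trans (X Y Z : C) :
  isomorphic X Y -> isomorphic Y Z -> isomorphic X Z.
Proof. by case=> f fi [g gi]; exists (g ∘ f); apply: is_iso_comp. Qed.

Lemma iso_mono (W X Y : C) (f : Hom X Y) (u v : Hom W X) :
  is_iso f -> f ∘ u = f ∘ v -> u = v.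
Proof. by case=> g [gf _] /(congr1 (comp g)); rewrite !compA gf !compIm. Qed.

Lemma iso_epi (X Y Z : C) (f : Hom X Y) (u v : Hom Y Z) :
  is_iso f -> u ∘ f = v ∘ f -> u = v.
Proof.
by case=> g [_ fg] /(congr1 (fun w => w ∘ g)); rewrite -!compA fg !compmI.
Qed.

Lemma hom0_isol (X X' Y : C) : isomorphic X X' -> hom0 X Y -> hom0 X' Y.
Proof. by case=> f fi XY u v; apply: (iso_epi fi); apply: XY. Qed.

Lemma hom0_isor (X Y Y' : C) : isomorphic Y Y' -> hom0 X Y -> hom0 X Y'.
Proof.
case=> f [g [gf fg]] XY u v.
have gi : is_iso g by exists f.
by apply: (iso_mono gi); apply: XY.
Qed.

Lemma iso_comp_bij (X Y Z : C) (f : Hom Y Z) :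
  is_iso f -> bijective (fun u : Hom X Y => f ∘ u).
Proof.
by case=> g [gf fg]; exists (comp g) => u; rewrite compA ?gf ?fg compIm.
Qed.

Lemma comp_iso_bij (X Y Z : C) (f : Hom X Y) :
  is_iso f -> bijective (fun u : Hom Y Z => u ∘ f).
Proof.
case=> g [gf fg]; exists (fun u => u ∘ g) => u; rewrite -compA ?gf ?fg.
  by rewrite compmI.
by rewrite compmI.
Qed.

End Categories.

Lemma is_iso_fmap (C C' : category) (G : functor C C') (X Y : C)
    (f : Hom X Y) : is_iso f -> is_iso (fmap G f).
Proof.
by case=> g [gf fg]; exists (fmap G g); rewrite -!fmap_comp gf fg !fmap_id.
Qed.

Lemma bijP (A B : Type) (f : A -> B) :
  injective f -> (forall b, exists a, f a = b) -> bijective f.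
Proof.
move=> fI fS; pose g b := projT1 (cid (fS b)).
have gK b : f (g b) = b by rewrite /g; case: cid.
by exists g => // a; apply: fI.
Qed.

Lemma bij_surj (A B : Type) (f : A -> B) :
  bijective f -> forall b, exists a, f a = b.
Proof. by case=> g _ gK b; exists (g b). Qed.

Section Triangles.
Variable D : tricat.
Implicit Types X Y Z W : D.

Let tD := tricP D.
Local Notation "0" := (GRing.zero) : cat_scope.

Lemma comp0m X Y Z (f : Hom X Y) : (0 : Hom Y Z) ∘ f = 0.
Proof. by apply: (@addrI _ (0 ∘ f)); rewrite -(compDl tD) !addr0. Qed.

Lemma compm0 X Y Z (f : Hom Y Z) : f ∘ (0 : Hom X Y) = 0.
Proof. by apply: (@addrI _ (f ∘ 0)); rewrite -(compDr tD) !addr0. Qed.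

Lemma compNm X Y Z (g : Hom Y Z) (f : Hom X Y) : (- g)%R ∘ f = (- (g ∘ f))%R.
Proof.
by apply: (addrI (g ∘ f)); rewrite subrr -(compDl tD) subrr comp0m.
Qed.

Lemma compmN X Y Z (g : Hom Y Z) (f : Hom X Y) : g ∘ (- f)%R = (- (g ∘ f))%R.
Proof.
by apply: (addrI (g ∘ f)); rewrite subrr -(compDr tD) subrr compm0.
Qed.

Lemma fmap_shift0 X Y : fmap shift (0 : Hom X Y) = 0.
Proof. by apply: (@addrI _ (fmap shift 0)); rewrite -(shift_add tD) !addr0. Qed.

Lemma shift_lift X Y (u : Hom (shift X) (shift Y)) :
  exists v : Hom X Y, fmap shift v = u.
Proof. exact: bij_surj (shift_ff tD X Y) u. Qed.

Lemma fmap_shift_inj X Y : injective (@fmap _ _ (@shift D) X Y).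
Proof. exact: bij_inj (shift_ff tD X Y). Qed.

Lemma is_isoN X : is_iso (- idm X)%R.
Proof. by exists (- idm X)%R; rewrite compmN compNm opprK compIm. Qed.

Lemma hom00 X Y : hom0 X Y <-> forall f : Hom X Y, f = 0.
Proof. by split=> [XY f|XY f g]; [apply: XY | rewrite (XY f) (XY g)]. Qed.

Lemma hom0_shift X Y : hom0 (shift X) (shift Y) <-> hom0 X Y.
Proof.
split=> XY u v; first by apply: fmap_shift_inj; apply: XY.
have [u' <-] := shift_lift u; have [v' <-] := shift_lift v.
by rewrite (XY u' v').
Qed.

Lemma zero_shift X : zero_object X -> hom0 (shift X) (shift X).
Proof.
move=> X0; apply/hom0_shift => f g.
by have [[w [_ wP]] _] := X0 X; rewrite -(wP f I) (wP g I).
Qed.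

Lemma zero_objectP X : zero_object X <-> idm X = 0.
Proof.
split=> [X0|X0 Y].
  by have [[w [_ wP]] _] := X0 X; rewrite -(wP (idm X) I) (wP 0 I).
split; exists 0; split=> // f _.
  by rewrite -[f]compmI X0 compm0.
by rewrite -[f]compIm X0 comp0m.
Qed.

Lemma zero_hom0l X Y : zero_object X -> hom0 X Y.
Proof. by case/(_ Y) => -[w [_ wP]] _ f g; rewrite -(wP f I) (wP g I). Qed.

Lemma zero_hom0r X Y : zero_object Y -> hom0 X Y.
Proof. by case/(_ X) => _ [w [_ wP]] f g; rewrite -(wP f I) (wP g I). Qed.

(** The maps of a triangle are forgotten where only membership in subcategories or the vanishing of
    Hom is read off from it. *)
Definition tri X Y Z : Prop :=
  exists (f : Hom X Y) (g : Hom Y Z) (h : Hom Z (shift X)), dist f g h.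

Lemma dist_tri X Y Z (f : Hom X Y) (g : Hom Y Z) (h : Hom Z (shift X)) :
  dist f g h -> tri X Y Z.
Proof. by exists f, g, h. Qed.

Lemma tri_rot X Y Z : tri X Y Z -> tri Y Z (shift X).
Proof. by case=> f [g [h /(dist_rot tD)]]; apply: dist_tri. Qed.

Lemma dist_zero X Z : zero_object Z ->
  dist (0 : Hom Z X) (idm X) (0 : Hom X (shift Z)).
Proof.
move=> Z0; apply/(dist_rot tD); rewrite fmap_shift0 oppr0.
by apply: (dist_id tD); apply/zero_objectP; apply/(zero_shift Z0).
Qed.

(** The pair [(0, u)] starts a morphism to the triangle 0 -> W -> W, whose third component is
    [v]. *)
Lemma dist_fact X Y Z W (f : Hom X Y) (g : Hom Y Z) (h : Hom Z (shift X))
    (u : Hom Y W) :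
  dist f g h -> u ∘ f = 0 -> exists v : Hom Z W, v ∘ g = u.
Proof.
move=> fgh uf0; have [O O0] := has_zero tD.
have [|v [vP _]] :=
    dist_mor tD (a := 0 : Hom X O) (b := u) fgh (dist_zero W O0).
  by rewrite compm0.
by exists v; rewrite -vP compIm.
Qed.

(** The triangle W -> 0 -> W[1] is mapped to the rotated triangle. The third component W[1] -> X[1]
    comes from a map W -> X because the shift is fully faithful. *)
Lemma dist_lift X Y Z W (f : Hom X Y) (g : Hom Y Z) (h : Hom Z (shift X))
    (u : Hom W Y) :
  dist f g h -> g ∘ u = 0 -> exists v : Hom W X, f ∘ v = u.
Proof.
move=> /(dist_rot tD) fgh gu0; have [O O0] := has_zero tD.
have /(dist_rot tD) WO := dist_id tD W O0.
have [|v [_]] := dist_mor tD (a := u) (b := 0 : Hom O Z) WO fgh.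
  by rewrite gu0 comp0m.
have [w <-] := shift_lift v.
rewrite fmap_id compNm compmN compmI => /oppr_inj; rewrite -fmap_comp.
by move/fmap_shift_inj; exists w.
Qed.

Lemma dist_comp0 X Y Z (f : Hom X Y) (g : Hom Y Z) (h : Hom Z (shift X)) :
  dist f g h -> g ∘ f = 0.
Proof.
move=> fgh; have [O O0] := has_zero tD.
have [|v [vP _]] :=
    dist_mor tD (a := idm X) (b := f) (dist_id tD X O0) fgh.
  by [].
by rewrite vP compm0.
Qed.

(* The shift is only an equivalence, so that the inverse shift of Z is an
   object whose shift is isomorphic to Z. *)
Lemma dist_unrot X Y Z (f : Hom X Y) (g : Hom Y Z) (h : Hom Z (shift X)) :
  dist f g h -> exists Z', isomorphic (shift Z') Z /\
    exists (u : Hom Z' X) (w : Hom Y (shift Z')), dist u f w.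
Proof.
move=> fgh; have [Z' [c ci]] := shift_es tD Z.
exists Z'; split; first by exists c.
have [c' [c'c cc']] := ci.
have [u uP] := shift_lift (- (h ∘ c))%R.
exists u, (c' ∘ g); apply/(dist_rot tD); rewrite uP opprK.
have c'i : is_iso c' by exists c.
apply: (dist_iso tD (is_iso_id X) (is_iso_id Y) c'i _ _ _ fgh).
- by rewrite compIm compmI.
- by rewrite compmI.
- by rewrite -compA cc' fmap_id compmI compIm.
Qed.

Lemma tri_iso X Y Z X' Y' Z' : isomorphic X X' -> isomorphic Y Y' ->
  isomorphic Z Z' -> tri X Y Z -> tri X' Y' Z'.
Proof.
move=> [a ai] [b bi] [c ci] [f [g [h fgh]]].
have [a' [a'a aa']] := ai; have [b' [b'b bb']] := bi.
have [c' [c'c cc']] := ci.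
exists (b ∘ f ∘ a'), (c ∘ g ∘ b'), (fmap shift a ∘ h ∘ c').
apply: (dist_iso tD ai bi ci _ _ _ fgh).
- by rewrite -compA a'a compmI.
- by rewrite -compA b'b compmI.
- by rewrite -compA c'c compmI.
Qed.

Lemma tri_unshift X Y Z : tri (shift X) (shift Y) (shift Z) -> tri X Y Z.
Proof.
case=> f [g [h fgh]]; have [f' fE] := shift_lift f.
have [g' gE] := shift_lift g; have [h' hE] := shift_lift (- h)%R.
exists f', g', h'; do 3!apply/(dist_rot tD).
apply: (dist_iso tD (is_iso_id _) (is_isoN _) (is_iso_id _) _ _ _ fgh).
- by rewrite fE compmI compNm compIm.
- by rewrite gE compmN compmI opprK compIm.
- by rewrite hE opprK compmI fmap_id compIm.
Qed.

Lemma unshift X : exists X', isomorphic (shift X') X.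
Proof. exact: (shift_es tD X). Qed.

Lemma tri_hom0l X Y Z W : tri X Y Z -> hom0 X W -> hom0 Z W -> hom0 Y W.
Proof.
case=> f [g [h fgh]] /hom00 X0 /hom00 Z0; apply/hom00 => u.
by have [v <-] := dist_fact fgh (X0 (u ∘ f)); rewrite (Z0 v) comp0m.
Qed.

Lemma tri_hom0r X Y Z W : tri X Y Z -> hom0 W X -> hom0 W Z -> hom0 W Y.
Proof.
case=> f [g [h fgh]] /hom00 X0 /hom00 Z0; apply/hom00 => u.
by have [v <-] := dist_lift fgh (Z0 (g ∘ u)); rewrite (X0 v) compm0.
Qed.

(** One octahedron: the cone of a composite is an extension of the two cones. It splices truncation
    triangles. *)
Lemma tri_comp X Y Z B B' (a : Hom X Y) (b : Hom Y B) (c : Hom B (shift X))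
    (a' : Hom Y Z) (b' : Hom Z B') (c' : Hom B' (shift Y)) :
  dist a b c -> dist a' b' c' -> exists C, tri X Z C /\ tri B C B'.
Proof.
move=> abc abc'; have [C [k1 [k2 kP]]] := dist_cone tD (a' ∘ a).
have [u [v [uv _ _]]] := dist_oct tD abc abc' kP.
by exists C; split; [apply: dist_tri kP | apply: dist_tri uv].
Qed.

(** The octahedron for fibres: after rotation the fibres appear as shifted cones, and the triangle
    found between the cones is shifted back. *)
Lemma tri_fiber X Y Z P Q (p : Hom P X) (f : Hom X Y) (a : Hom Y (shift P))
    (q : Hom Q Y) (g : Hom Y Z) (b : Hom Z (shift Q)) :
  dist p f a -> dist q g b -> exists W,
    (exists (w : Hom W X) (c : Hom Z (shift W)), dist w (g ∘ f) c) /\ tri P W Q.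
Proof.
move=> /(dist_rot tD) fP /(dist_rot tD) gP.
have [V [k1 [k2 kP]]] := dist_cone tD (g ∘ f).
have [u [v [uv _ _]]] := dist_oct tD fP gP kP.
have [W [WV [w [c wP]]]] := dist_unrot kP.
exists W; split; first by exists w, c.
apply: tri_unshift.
apply: (tri_iso _ _ _ (dist_tri uv)); last exact: isomorphic_refl.
  exact: isomorphic_refl.
exact: isomorphic_sym.
Qed.

Section Subcategories.
Variable A : subcat D.

Lemma sub_unshift X : A (shift X) -> A X.
Proof. by case: (sub_shift A X). Qed.

Lemma sub_tri3 X Y Z : tri X Y Z -> A X -> A Y -> A Z.
Proof. by case=> f [g [h fgh]]; apply: (sub_cone fgh). Qed.

Lemma sub_tri2 X Y Z : tri X Y Z -> A X -> A Z -> A Y.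
Proof.
by move=> /tri_rot/tri_rot fgh /sub_shift AX AZ; apply/sub_shift/(sub_tri3 fgh).
Qed.

Lemma sub_tri1 X Y Z : tri X Y Z -> A Y -> A Z -> A X.
Proof. by move=> /tri_rot fgh AY AZ; apply/sub_shift/(sub_tri3 fgh). Qed.

Lemma left_orth_shift X : left_orth A (shift X) <-> left_orth A X.
Proof.
split=> XA Y AY.
  by apply/hom0_shift/XA; apply: (proj1 (sub_shift A Y)).
have [Y' YY'] := unshift Y; apply: (hom0_isor YY'); apply/hom0_shift/XA.
by apply/sub_shift/sub_iso/AY/isomorphic_sym.
Qed.

Lemma right_orth_shift X : right_orth A (shift X) <-> right_orth A X.
Proof.
split=> XA Y AY.
  by apply/hom0_shift/XA; apply: (proj1 (sub_shift A Y)).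
have [Y' YY'] := unshift Y; apply: (hom0_isol YY'); apply/hom0_shift/XA.
by apply/sub_shift/sub_iso/AY/isomorphic_sym.
Qed.

Lemma left_orth_tri2 X Y Z :
  tri X Y Z -> left_orth A X -> left_orth A Z -> left_orth A Y.
Proof.
by move=> XYZ XA ZA W AW; apply: (tri_hom0l XYZ); [apply: XA | apply: ZA].
Qed.

Lemma left_orth_tri1 X Y Z :
  tri X Y Z -> left_orth A Y -> left_orth A Z -> left_orth A X.
Proof.
move=> /tri_rot XYZ YA ZA; apply/left_orth_shift.
by apply: (left_orth_tri2 (tri_rot XYZ)) => //; apply/left_orth_shift.
Qed.

Lemma left_orth_tri3 X Y Z :
  tri X Y Z -> left_orth A X -> left_orth A Y -> left_orth A Z.
Proof.
move=> /tri_rot XYZ XA YA; apply: (left_orth_tri2 XYZ) => //.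
exact/left_orth_shift.
Qed.

Lemma right_orth_tri2 X Y Z :
  tri X Y Z -> right_orth A X -> right_orth A Z -> right_orth A Y.
Proof.
by move=> XYZ XA ZA W AW; apply: (tri_hom0r XYZ); [apply: XA | apply: ZA].
Qed.

Lemma right_orth_tri1 X Y Z :
  tri X Y Z -> right_orth A Y -> right_orth A Z -> right_orth A X.
Proof.
move=> /tri_rot XYZ YA ZA; apply/right_orth_shift.
by apply: (right_orth_tri2 (tri_rot XYZ)) => //; apply/right_orth_shift.
Qed.

Lemma right_orth_tri3 X Y Z :
  tri X Y Z -> right_orth A X -> right_orth A Y -> right_orth A Z.
Proof.
move=> /tri_rot XYZ XA YA; apply: (right_orth_tri2 XYZ) => //.
exact/right_orth_shift.
Qed.

(** [e] is the unit of the adjunction; by naturality the bijection on Hom is precomposition with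
    it. *)
Lemma left_admissible_arrow : left_admissible A ->
  forall X, exists (Y : D) (e : Hom X Y), [/\ A Y,
    forall Z (u : Hom X Z), A Z -> exists t : Hom Y Z, t ∘ e = u &
    forall Z (t : Hom Y Z), A Z -> t ∘ e = 0 -> t = 0].
Proof.
case=> G [phi [phiB phil phir]] X.
pose e : Hom X (sval (G X)) := phi X (G X) (idm (G X)).
have eP (Z : sub A) (u : @Hom D (sval (G X)) (sval Z)) : phi X Z u = u ∘ e.
  by have := phir X (G X) Z u (idm (G X)); rewrite compmI.
exists (sval (G X)), e; split=> [|Z u AZ|Z t AZ te0]; first exact: svalP.
  have [t tE] := bij_surj (phiB X (exist _ Z AZ)) u.
  by exists t; rewrite -tE; exact/esym/(eP (exist _ Z AZ)).
apply: (bij_inj (phiB X (exist _ Z AZ))).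
by rewrite (eP (exist _ Z AZ) t) (eP (exist _ Z AZ) 0) te0 comp0m.
Qed.

Lemma right_admissible_arrow : right_admissible A ->
  forall X, exists (Y : D) (e : Hom Y X), [/\ A Y,
    forall Z (u : Hom Z X), A Z -> exists t : Hom Z Y, e ∘ t = u &
    forall Z (t : Hom Z Y), A Z -> e ∘ t = 0 -> t = 0].
Proof.
case=> G [phi [phiB phil phir]] X.
have [e eE] := bij_surj (phiB (G X) X) (idm (G X)).
have eP (Z : sub A) (u : @Hom D (sval Z) (sval (G X))) :
    phi Z X ((e : @Hom D (sval (G X)) X) ∘ u) = u.
  by have := phil (G X) Z X u e; rewrite eE compIm.
exists (sval (G X)), e; split=> [|Z u AZ|Z t AZ et0]; first exact: svalP.
  exists (phi (exist _ Z AZ) X u).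
  by apply: (bij_inj (phiB (exist _ Z AZ) X)); rewrite eP.
rewrite -(eP (exist _ Z AZ) t) et0 -[RHS](eP (exist _ Z AZ) 0).
by rewrite compm0.
Qed.

(** X0 is the fibre of the unit [e]. A map from the cone of [e] to Z in A vanishes on Y by
    uniqueness, so it factors through X[1], there through [e[1]], and [e[1]] kills the connecting
    map. *)
Lemma left_admissible_tri : left_admissible A ->
  forall X, exists X0 Y, [/\ tri X0 X Y, left_orth A X0 & A Y].
Proof.
move=> /left_admissible_arrow lA X; have [Y [e [AY eS eI]]] := lA X.
have [C [g [h egh]]] := dist_cone tD e.
have [X0 [X0C [u [w uP]]]] := dist_unrot egh.
exists X0, Y; split=> //; first exact: dist_tri uP.
apply/left_orth_shift => Z AZ; apply: (hom0_isol (isomorphic_sym X0C)).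
apply/hom00 => v.
have vg0 : v ∘ g = 0.
  by apply: eI => //; rewrite -compA (dist_comp0 egh) compm0.
have [v' <-] := dist_fact (proj1 (dist_rot tD _ _ _) egh) vg0.
have [Z' [c ci]] := unshift Z; have [c' [c'c cc']] := ci.
have AZ' : A Z' by apply/sub_unshift/sub_iso/AZ; exists c', c.
have [t tE] := shift_lift (c' ∘ v').
have [t' t'E] := eS _ t AZ'.
have -> : v' = c ∘ fmap shift (t' ∘ e) by rewrite t'E tE compA cc' compIm.
have /(dist_rot tD)/(dist_rot tD)/dist_comp0 := egh.
rewrite compNm fmap_comp -!compA => /eqP; rewrite oppr_eq0 => /eqP ->.
by rewrite !compm0.
Qed.

(** X0 is the cone of the counit. A map to it from Z in A dies in Y[1] by uniqueness, so it lifts to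
    X, then to Y, and two consecutive maps of a triangle compose to zero. *)
Lemma right_admissible_tri : right_admissible A ->
  forall X, exists Y X0, [/\ tri Y X X0, A Y & right_orth A X0].
Proof.
move=> /right_admissible_arrow rA X; have [Y [e [AY eS eI]]] := rA X.
have [C [g [h egh]]] := dist_cone tD e.
exists Y, C; split=> //; first exact: dist_tri egh.
move=> Z AZ; apply/hom00 => v.
have [Z' [c ci]] := unshift Z; have [c' [c'c cc']] := ci.
have AZ' : A Z' by apply/sub_unshift/sub_iso/AZ; exists c', c.
have [t tE] := shift_lift (h ∘ v ∘ c).
have t0 : t = 0.
  apply: eI => //; apply: fmap_shift_inj.
  rewrite fmap_shift0 fmap_comp tE !compA.
  have /(dist_rot tD)/(dist_rot tD)/dist_comp0 := egh.
  by rewrite compNm => /eqP; rewrite oppr_eq0 => /eqP ->; rewrite !comp0m.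
have hv0 : h ∘ v = 0.
  by rewrite -[v]compmI -cc' 2!compA -tE t0 fmap_shift0 comp0m.
have [v' <-] := dist_lift (proj1 (dist_rot tD _ _ _) egh) hv0.
have [v'' <-] := eS _ v' AZ.
by rewrite compA (dist_comp0 egh) comp0m.
Qed.

End Subcategories.
End Triangles.

(** * Local objects *)

Section LocalObjects.
Variables (C : category) (S : forall X Y : C, Hom X Y -> Prop).
Local Notation Q := (localization S).
Local Notation loc := (@loc_mor _ S _ _).

Lemma loc_mor_iso (X Y : C) (s : Hom X Y) :
  S s -> is_iso (loc s : @Hom Q X Y).
Proof.
move=> Ss; exists (loc_class (zbwd Ss (znil S X))) => /=; split.
  by rewrite loc_compE; apply/loc_classP/zeq_fwd_bwd.
by rewrite loc_compE; apply/loc_classP/zeq_bwd_fwd.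
Qed.

(* If composing with each s in S is a bijection on Hom(X, -), then a zigzag
   from A to B acts as a map from Hom(X, A) to Hom(X, B). *)
Lemma loc_mor_bij_left (X : C) :
  (forall (Y Z : C) (s : Hom Y Z),
     S s -> bijective (fun u : Hom X Y => s ∘ u)) ->
  forall Y : C, bijective (fun f : Hom X Y => loc f).
Proof.
move=> XS.
have div_ex (Y Z : C) (s : Hom Y Z) (Ss : S s) : exists d : Hom X Z -> Hom X Y,
    (forall u, s ∘ d u = u) /\ (forall u, d (s ∘ u) = u).
  by case: (XS _ _ _ Ss) => d dK sK; exists d.
pose div Y Z s Ss := projT1 (cid (@div_ex Y Z s Ss)).
have divK Y Z s (Ss : S s) u : s ∘ @div Y Z s Ss u = u.
  by rewrite /div; case: cid => d [].
have mulK Y Z s (Ss : S s) u : @div Y Z s Ss (s ∘ u) = u.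
  by rewrite /div; case: cid => d [].
pose act := fix act A B (p : zigzag S A B) : Hom X A -> Hom X B :=
  match p with
  | znil _ => id
  | zfwd _ _ _ f p' => fun u => act _ _ p' (f ∘ u)
  | zbwd _ _ _ s Ss p' => fun u => act _ _ p' (div _ _ s Ss u)
  end.
have act_zeq A B (p q : zigzag S A B) : zeq p q -> act _ _ p =1 act _ _ q.
  elim=> {A B p q} //=.
  - by move=> A B p q _ IH u; rewrite IH.
  - by move=> A B q p r _ IH _ IH' u; rewrite IH IH'.
  - by move=> A B A' f p q _ IH u; rewrite IH.
  - by move=> A B A' s Ss p q _ IH u; rewrite IH.
  - by move=> A B p u; rewrite compIm.
  - by move=> A B A' B' f g p u; rewrite compA.
  - by move=> A B A' s Ss p u; rewrite mulK.
  - by move=> A B A' s Ss p u; rewrite divK.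
(* In the localization, [u] followed by [p] is the single arrow obtained by letting [p] act on
   [u]. *)
have actE A B (p : zigzag S A B) (u : Hom X A) :
    zeq (zcat (zfwd u (znil S A)) p) (zfwd (act _ _ p u) (znil S B)).
  elim: p u => {A B} [A|A A' B f p IH|A A' B s Ss p IH] u /=.
  - exact: zeq_refl.
  - by apply: (zeq_trans _ (IH _)); apply: zeq_comp.
  - apply: (zeq_trans _ (IH _)) => /=; rewrite -[u in zfwd u _](divK _ _ _ Ss).
    apply: zeq_trans (zeq_sym (zeq_comp _ _ _)) _.
    exact/zeq_fwd/zeq_fwd_bwd.
(* Acting on the identity recovers a morphism from its class, and it turns every zigzag out of X
   into a single arrow. *)
move=> Y; apply: bijP => [f g /loc_classP/act_zeq/(_ (idm X))|p].
  by rewrite /= !compmI.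
exists (act _ _ (loc_repr p) (idm X)); rewrite -[RHS]loc_reprK.
apply/loc_classP; apply: (zeq_trans (zeq_sym (actE _ _ _ _))).
exact: zeq_id.
Qed.

(** Dual argument: a zigzag from A to B now acts contravariantly, from Hom(B, Y) to Hom(A, Y). *)
Lemma loc_mor_bij_right (Y : C) :
  (forall (W X : C) (s : Hom W X),
     S s -> bijective (fun u : Hom X Y => u ∘ s)) ->
  forall X : C, bijective (fun f : Hom X Y => loc f).
Proof.
move=> YS.
have div_ex (W X : C) (s : Hom W X) (Ss : S s) : exists d : Hom W Y -> Hom X Y,
    (forall u, d u ∘ s = u) /\ (forall u, d (u ∘ s) = u).
  by case: (YS _ _ _ Ss) => d dK sK; exists d.
pose div W X s Ss := projT1 (cid (@div_ex W X s Ss)).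
have divK W X s (Ss : S s) u : @div W X s Ss u ∘ s = u.
  by rewrite /div; case: cid => d [].
have mulK W X s (Ss : S s) u : @div W X s Ss (u ∘ s) = u.
  by rewrite /div; case: cid => d [].
pose act := fix act A B (p : zigzag S A B) : Hom B Y -> Hom A Y :=
  match p with
  | znil _ => id
  | zfwd _ _ _ f p' => fun u => act _ _ p' u ∘ f
  | zbwd _ _ _ s Ss p' => fun u => div _ _ s Ss (act _ _ p' u)
  end.
have act_zeq A B (p q : zigzag S A B) : zeq p q -> act _ _ p =1 act _ _ q.
  elim=> {A B p q} //=.
  - by move=> A B p q _ IH u; rewrite IH.
  - by move=> A B q p r _ IH _ IH' u; rewrite IH IH'.
  - by move=> A B A' f p q _ IH u; rewrite IH.
  - by move=> A B A' s Ss p q _ IH u; rewrite IH.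
  - by move=> A B p u; rewrite compmI.
  - by move=> A B A' B' f g p u; rewrite compA.
  - by move=> A B A' s Ss p u; rewrite divK.
  - by move=> A B A' s Ss p u; rewrite mulK.
have actE A B (p : zigzag S A B) (u : Hom B Y) :
    zeq (zcat p (zfwd u (znil S Y))) (zfwd (act _ _ p u) (znil S Y)).
  elim: p u => {A B} [A|A A' B f p IH|A A' B s Ss p IH] u /=.
  - exact: zeq_refl.
  - by apply: (zeq_trans (zeq_fwd _ (IH _))); apply: zeq_comp.
  - apply: (zeq_trans (zeq_bwd Ss (IH _))).
    rewrite -[X in zfwd X _](divK _ _ _ Ss).
    apply: (zeq_trans (zeq_bwd Ss (zeq_sym (zeq_comp _ _ _)))).
    exact: zeq_bwd_fwd.
move=> X; apply: bijP => [f g /loc_classP/act_zeq/(_ (idm Y))|p].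
  by rewrite /= !compIm.
exists (act _ _ (loc_repr p) (idm Y)); rewrite -[RHS]loc_reprK.
apply/loc_classP; apply: (zeq_trans (zeq_sym (actE _ _ _ _))).
rewrite -[X in zeq _ X]zcat_nil; apply: zeq_cat; first exact: zeq_refl.
exact: zeq_id.
Qed.

End LocalObjects.

(** * Morphisms with cone in A, seen from objects orthogonal to A *)

Section DistBijections.
Variable D : tricat.
Let tD := tricP D.

(** Surjectivity comes from Hom(W, Z) = 0. For injectivity, the shift of [u - v] is killed by
    [f[1]], so it factors through a map W[1] -> Z. *)
Lemma dist_post_bij (W X Y Z : D) (f : Hom X Y) (g : Hom Y Z)
    (h : Hom Z (shift X)) :
  dist f g h -> hom0 W Z -> hom0 (shift W) Z ->
  bijective (fun u : Hom W X => f ∘ u).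
Proof.
move=> fgh WZ W1Z; apply: bijP => [u v fuv|u]; last first.
  exact: (dist_lift fgh (WZ _ _)).
apply/eqP; rewrite -subr_eq0; apply/eqP; apply: fmap_shift_inj.
have fw0 : (- fmap shift f)%R ∘ fmap shift (u - v)%R = 0%R.
  rewrite compNm -fmap_comp (compDr tD) compmN fuv subrr.
  by rewrite fmap_shift0 oppr0.
move: fgh => /(dist_rot tD)/(dist_rot tD) fgh.
have [w <-] := dist_lift fgh fw0.
by rewrite (W1Z w 0%R) compm0 fmap_shift0.
Qed.

Lemma dist_pre_bij (X Y Z W : D) (f : Hom X Y) (g : Hom Y Z)
    (h : Hom Z (shift X)) :
  dist f g h -> hom0 X W -> hom0 (shift X) W ->
  bijective (fun u : Hom Z W => u ∘ g).
Proof.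
move=> fgh XW X1W; apply: bijP => [u v guv|u]; last first.
  exact: (dist_fact fgh (XW _ _)).
apply/eqP; rewrite -subr_eq0; apply/eqP.
have wg0 : (u - v)%R ∘ g = 0%R by rewrite (compDl tD) compNm guv subrr.
move: fgh => /(dist_rot tD) fgh.
have [w <-] := dist_fact fgh wg0.
by rewrite (X1W w 0%R) comp0m.
Qed.

Variable A : subcat D.

Lemma left_orth_post_bij (W X Y : D) (s : Hom X Y) :
  left_orth A W -> cone_in A s -> bijective (fun u : Hom W X => s ∘ u).
Proof.
move=> WA [Z [g [h [sgh AZ]]]]; apply: (dist_post_bij sgh); first exact: WA.
exact: (proj2 (left_orth_shift A W) WA Z AZ).
Qed.

(** Maps into W are tested on the fibre of [s], so the triangle is first rotated back. *)
Lemma right_orth_pre_bij (X Y W : D) (s : Hom X Y) :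
  right_orth A W -> cone_in A s -> bijective (fun u : Hom Y W => u ∘ s).
Proof.
move=> WA [Z [g [h [sgh AZ]]]]; have [Z' [ZZ' [u [w usw]]]] := dist_unrot sgh.
have AZ1 : A (shift Z') by apply/sub_iso/AZ/isomorphic_sym.
apply: (dist_pre_bij usw); first exact/WA/sub_unshift.
exact: WA.
Qed.

End DistBijections.

(** * t-structures on a Verdier quotient *)

Section Quotient.
Variables (T : tricat) (N : subcat T).
Local Notation Q := (verdier N).
Local Notation loc := (loc_mor (cone_in N)).
Implicit Types X Y Z : T.
Let tT := tricP T.

Lemma verdier_left_bij X Y :
  left_orth N X -> bijective (fun f : Hom X Y => loc f).
Proof.
by move=> XN; apply: loc_mor_bij_left => {}Y Z s; apply: left_orth_post_bij.
Qed.

Lemma verdier_right_bij X Y :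
  right_orth N Y -> bijective (fun f : Hom X Y => loc f).
Proof.
by move=> YN; apply: loc_mor_bij_right => W {}X s; apply: right_orth_pre_bij.
Qed.

Lemma verdier_hom0_left X Y :
  left_orth N X -> (@hom0 Q X Y <-> hom0 X Y).
Proof.
move=> XN; have locB := verdier_left_bij Y XN; split=> XY f g.
  by apply: (bij_inj locB); apply: XY.
have [f' <-] := bij_surj locB f; have [g' <-] := bij_surj locB g.
by rewrite (XY f' g').
Qed.

Lemma verdier_hom0_right X Y :
  right_orth N Y -> (@hom0 Q X Y <-> hom0 X Y).
Proof.
move=> YN; have locB := verdier_right_bij X YN; split=> XY f g.
  by apply: (bij_inj locB); apply: XY.
have [f' <-] := bij_surj locB f; have [g' <-] := bij_surj locB g.
by rewrite (XY f' g').
Qed.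

Lemma verdier_iso12 X Y P : tri X Y P -> N P -> @isomorphic Q X Y.
Proof.
case=> f [g [h fgh]] NP; exists (loc f); apply: loc_mor_iso.
by exists P, g, h.
Qed.

Lemma verdier_iso23 X Y P : tri P X Y -> N P -> @isomorphic Q X Y.
Proof.
by move=> /tri_rot XYP NP; apply: (verdier_iso12 XYP); apply/(sub_shift N P).
Qed.

Lemma verdier_isoT X Y : isomorphic X Y -> @isomorphic Q X Y.
Proof.
by case=> f /(is_iso_fmap (loc_functor (cone_in N))) fi; exists (loc f).
Qed.

Lemma verdier_dist_loc X Y Z (f : Hom X Y) (g : Hom Y Z)
    (h : Hom Z (shift X)) :
  dist f g h -> @dist Q X Y Z (loc f) (loc g) (loc h).
Proof.
move=> fgh; exists X, Y, Z, f, g, h; split=> //.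
exists (@idm Q X), (@idm Q Y), (@idm Q Z).
split; first by split; apply: is_iso_id.
by rewrite fmap_id !compIm !compmI.
Qed.

Hypothesis N_left : forall X,
  exists X0 Y, [/\ tri X0 X Y, left_orth N X0 & N Y].
Hypothesis N_right : forall X,
  exists Y X0, [/\ tri Y X X0, N Y & right_orth N X0].

Lemma verdier_zero_hom0 X Y : N X -> @hom0 Q X Y.
Proof.
move=> NX; have [Y1 [Y0 [Y1YY0 NY1 Y0N]]] := N_right Y.
apply: (hom0_isor (isomorphic_sym (verdier_iso23 Y1YY0 NY1))).
exact/(verdier_hom0_right _ Y0N)/Y0N.
Qed.

Lemma verdier_hom0_zero X Y : N Y -> @hom0 Q X Y.
Proof.
move=> NY; have [X0 [X1 [X0XX1 X0N NX1]]] := N_left X.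
apply: (hom0_isol (verdier_iso12 X0XX1 NX1)).
exact/(verdier_hom0_left _ X0N)/X0N.
Qed.

(** This detects membership in N from the quotient. On maps out of X0 the categories T and T/N
    agree; there [s] is both zero and invertible, which forces X0 = 0, so X is X1 up to
    isomorphism. *)
Lemma verdier_loc_id0 X : loc (idm X) = loc 0%R -> N X.
Proof.
move=> id0; have [X0 [X1 [X0XX1 X0N NX1]]] := N_left X.
apply: (sub_tri2 X0XX1) => //; apply/sub_zero/zero_objectP.
have [s [g [h sgh]]] := X0XX1.
have s0 : s = 0%R.
  apply: (bij_inj (verdier_left_bij X X0N)).
  by rewrite -[s in LHS]compIm loc_mor_comp id0 -loc_mor_comp comp0m.
have si : is_iso (loc s : @Hom Q X0 X) by apply: loc_mor_iso; exists X1, g, h.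
apply: (bij_inj (verdier_left_bij X0 X0N)); apply: (iso_mono si).
by rewrite -!(@loc_mor_comp _ (cone_in N)) s0 !comp0m.
Qed.

(** W is the left orthogonal part of X. The left orthogonal parts of X and Y are isomorphic in the
    quotient, hence already in T, since maps out of them are unchanged. *)
Lemma verdier_roof X Y : @isomorphic Q X Y ->
  exists W P P', [/\ left_orth N W, tri W X P, tri W Y P', N P & N P'].
Proof.
move=> XY; have [X0 [P [X0XP X0N NP]]] := N_left X.
have [Y0 [P' [Y0YP' Y0N NP']]] := N_left Y.
exists X0, P, P'; split=> //.
have : @isomorphic Q X0 Y0.
  apply: isomorphic_trans (verdier_iso12 X0XP NP) _.
  exact: isomorphic_trans XY (isomorphic_sym (verdier_iso12 Y0YP' NP')).
case=> f [g [gf fg]].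
have [f' fE] := bij_surj (verdier_left_bij Y0 X0N) f.
have [g' gE] := bij_surj (verdier_left_bij X0 Y0N) g.
apply: (tri_iso _ _ _ Y0YP'); [|exact: isomorphic_refl..].
exists g', f'; split.
  apply: (bij_inj (verdier_left_bij Y0 Y0N)) => /=.
  by rewrite loc_mor_comp fE gE fg loc_mor_id.
apply: (bij_inj (verdier_left_bij X0 X0N)) => /=.
by rewrite loc_mor_comp fE gE gf loc_mor_id.
Qed.

(** * Truncation triangles lifted from the quotient to T *)

Variable t : t_structure Q.

(** A triangle of the quotient is the image of one on some X1 isomorphic to X only in the quotient.
    Along the roof X1 <- W -> X, first the fibre of W -> B1 and then the cone of A -> X are taken;
    both outer terms change only by objects of N. *)
Lemma lift_truncation X :
  exists A B, [/\ tri A X B, le0 t A & ge1 t B].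
Proof.
have [A' [B' [f [g [h [leA geB]]]]]] := t_trunc t X.
case=> A1 [X1 [B1 [f1 [g1 [h1 [fgh1]]]]]].
case=> a [b [c [[ai bi ci] _]]].
have X1X : @isomorphic Q X1 X by exists b.
have leA1 : le0 t A1.
  by apply: (le0_iso (isomorphic_sym _) leA); exists a.
have geB1 : ge1 t B1.
  by apply: (ge1_iso (isomorphic_sym _) geB); exists c.
have [W [P [P' [WN WX1 WX NP NP']]]] := verdier_roof X1X.
have [u [v [w uvw]]] := WX1; have [P1 [P1P [p [q puq]]]] := dist_unrot uvw.
have NP1 : N P1 by apply/(sub_unshift (A := N))/sub_iso/NP/isomorphic_sym.
have [A [[y [z yz]] P1AA1]] := tri_fiber puq fgh1.
have leA' : le0 t A.
  exact: le0_iso (isomorphic_sym (verdier_iso23 P1AA1 NP1)) leA1.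
have [u' [v' [w' uvw']]] := WX.
have [B [AXB B1BP']] := tri_comp yz uvw'.
exists A, B; split=> //.
exact: ge1_iso (verdier_iso12 B1BP' NP') geB1.
Qed.

(** The part of B in N is moved over to A, which changes neither outer term in the quotient. *)
Lemma lift_truncation_right X : exists A B,
  [/\ tri A X B, le0 t A, ge1 t B & right_orth N B].
Proof.
have [A [B [[f [g [h fgh]]] leA geB]]] := lift_truncation X.
have [P [B0 [[p [q [r pqr]]] NP B0N]]] := N_right B.
have [A' [[y [z yz]] AA'P]] := tri_fiber fgh pqr.
exists A', B0; split=> //; first exact: dist_tri yz.
  exact: le0_iso (verdier_iso12 AA'P NP) leA.
exact: ge1_iso (verdier_iso23 (dist_tri pqr) NP) geB.
Qed.

(** The argument runs on a triangle of T over X0. The map X0 -> B vanishes in the quotient, hence in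
    T, so the identity of B factors through A[1]. This lies in the aisle, so B is zero in the
    quotient and X0 is A there. *)
Lemma le0P X : le0 t X <-> forall B, ge1 t B -> @hom0 Q X B.
Proof.
split=> [leX B geB|XB]; first exact: t_hom0 leX geB.
have [X0 [P [X0XP X0N NP]]] := N_left X.
have X0X := verdier_iso12 X0XP NP; apply: (le0_iso X0X).
have [A [B [[f [g [h fgh]]] leA geB]]] := lift_truncation X0.
suff NB : N B by apply: (le0_iso (verdier_iso12 (dist_tri fgh) NB)).
have g0 : g = 0%R.
  have X0B : @hom0 Q X0 B by apply: (hom0_isol (isomorphic_sym X0X)); apply: XB.
  exact: (proj1 (verdier_hom0_left _ X0N) X0B).
have [r rh] : exists r, r ∘ h = idm B.
  by apply: (dist_fact (proj1 (dist_rot tT _ _ _) fgh)); rewrite g0 compm0.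
apply: verdier_loc_id0; rewrite -rh loc_mor_comp.
by rewrite (t_hom0 (le0_shift leA) geB (loc r) (loc 0%R)) -loc_mor_comp comp0m.
Qed.

(** Dually, the vanishing of A -> X0 makes the identity of A factor through B[-1], which lies in the
    coaisle. *)
Lemma ge1P X : ge1 t X <-> forall A, le0 t A -> @hom0 Q A X.
Proof.
split=> [geX A leA|AX]; first exact: t_hom0 leA geX.
have [P [X0 [PXX0 NP X0N]]] := N_right X.
have XX0 := verdier_iso23 PXX0 NP.
apply: (ge1_iso (isomorphic_sym XX0)).
have [A [B [[f [g [h fgh]]] leA geB]]] := lift_truncation X0.
suff NA : N A.
  exact: ge1_iso (isomorphic_sym (verdier_iso23 (dist_tri fgh) NA)) geB.
have f0 : f = 0%R.
  have AX0 : @hom0 Q A X0 by apply: (hom0_isor XX0); apply: AX.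
  exact: (proj1 (verdier_hom0_right _ X0N) AX0).
have [B' [B'B [u [w ufw]]]] := dist_unrot fgh.
have geB' : ge1 t B'.
  apply: ge1_shift; apply: (ge1_iso _ geB).
  exact/verdier_isoT/isomorphic_sym.
have [r ur] : exists r, u ∘ r = idm A.
  by apply: (dist_lift ufw); rewrite f0 comp0m.
apply: verdier_loc_id0; rewrite -ur loc_mor_comp.
by rewrite (t_hom0 leA geB' (loc r) (loc 0%R)) -loc_mor_comp compm0.
Qed.

End Quotient.

(** * Join-primes of a finite distributive lattice *)

Section JoinPrimes.
Context {disp : Order.disp_t} {L : finTBDistrLatticeType disp}.
Implicit Types x y s r : L.

Lemma join_primeP s : join_prime s ->
  forall x y, s <= x `|` y -> (s <= x) || (s <= y).
Proof. by case/andP=> _ /forallP sP x y; apply/implyP/(forallP (sP x)). Qed.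

Lemma join_prime_neq0 s : join_prime s -> s != \bot.
Proof. by case/andP. Qed.

Lemma join_prime_joins s (P : pred L) : join_prime s ->
  s <= \join_(r | P r) r -> exists2 r, P r & s <= r.
Proof.
move=> sp; elim/big_rec: _ => [|r x Pr IH].
  by rewrite lex0 (negPf (join_prime_neq0 sp)).
by case/(join_primeP sp)/orP=> // sr; exists r.
Qed.

Lemma lt_wf_ind (P : L -> Prop) :
  (forall x, (forall y, y < x -> P y) -> P x) -> forall x, P x.
Proof.
move=> IH x; have [n] := ubnP #|[pred y | y < x]|.
elim: n x => // n IHn x; rewrite ltnS => xn; apply: IH => y yx.
apply: IHn; apply: (leq_trans _ xn); apply: proper_card.
apply/properP; split.
  by apply/subsetP => z; rewrite !inE => /lt_trans; apply.
by exists y; rewrite !inE ?ltxx.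
Qed.

(** Birkhoff's decomposition. If x is not join-prime, then x lies below some join of y and z but
    below neither. By distributivity x is the join of its meets with y and z, both strictly
    smaller. *)
Lemma join_primes_below x : \join_(r | join_prime r && (r <= x)) r = x.
Proof.
elim/lt_wf_ind: x => x IH; apply/le_anti/andP; split.
  by apply/joinsP => r /andP[].
have [->|x0] := eqVneq x \bot; first exact: le0x.
have [xp|] := boolP (join_prime x); first by apply: joins_sup; rewrite xp /=.
rewrite /join_prime x0 /= negb_forall => /existsP[y].
rewrite negb_forall => /existsP[z]; rewrite negb_imply negb_or.
case/and3P=> xyz xy xz.
have small w : ~~ (x <= w) ->
    x `&` w <= \join_(r | join_prime r && (r <= x)) r.
  move=> xw; rewrite -(IH (x `&` w)).
    apply/joinsP => r /andP[rp rxw]; apply: joins_sup.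
    by rewrite rp (le_trans rxw) ?leIl.
  by rewrite lt_neqAle leIl andbT; apply: contra xw => /eqP <-; apply: leIr.
rewrite -[X in X <= _](meet_l xyz) meetUr leUx.
by rewrite !small.
Qed.

Lemma join_prime_lt_join_lt s r : join_prime r -> r < s -> r <= join_lt s.
Proof. by move=> rp rs; apply: joins_sup; rewrite rp. Qed.

Lemma lt_le_join_lt s x : x < s -> x <= join_lt s.
Proof.
move=> xs; rewrite -[x]join_primes_below; apply/joinsP => r /andP[rp rx].
by apply: join_prime_lt_join_lt => //; apply: le_lt_trans xs.
Qed.

Lemma join_lt_lt s : join_prime s -> ~~ (s <= join_lt s).
Proof.
move=> sp; apply/negP => /(join_prime_joins sp)[r /andP[rp rs] sr].
by have := le_lt_trans sr rs; rewrite ltxx.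
Qed.

Lemma meet_le_join_lt s x : ~~ (s <= x) -> x `&` s <= join_lt s.
Proof.
move=> sx; apply: lt_le_join_lt; rewrite lt_neqAle leIr andbT.
by apply: contra sx => /eqP <-; apply: leIl.
Qed.

(** The induction step of the later constructions: s is a maximal join-prime below x, and y is the
    join of the others. Were s below y, it would lie below one of these others, against
    maximality. *)
Lemma join_prime_split x : x != \bot -> exists s y,
  [/\ join_prime s, y < x, y `|` s = x, join_lt s <= y & ~~ (s <= y)].
Proof.
move=> x0; pose P r := join_prime r && (r <= x).
have [s0 Ps0] : exists s0, P s0.
  have [s0 Ps0|nP] := pickP P; first by exists s0.
  by case/eqP: x0; rewrite -[x]join_primes_below big_pred0.
(* The size of the strict down-set is strictly monotone, so a maximizer is a maximal element. *)
pose m r := #|[pred y : L | y < r]|.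
case: (@arg_maxnP _ s0 P m Ps0) => s /andP[sp sx] smax.
pose y := \join_(r | P r && (r != s)) r.
have sy : ~~ (s <= y).
  apply/negP => /(join_prime_joins sp)[r /andP[Pr rs] sr].
  have sr' : s < r by rewrite lt_neqAle eq_sym rs.
  have := smax r Pr; apply/negP; rewrite -ltnNge.
  apply: proper_card; apply/properP; split.
    by apply/subsetP => z; rewrite !inE => /lt_trans; apply.
  by exists s; rewrite !inE ?ltxx.
have yx : y <= x by apply/joinsP => r /andP[/andP[]].
exists s, y; split=> //.
- by rewrite lt_neqAle yx andbT; apply: contra sy => /eqP ->.
- apply/le_anti; rewrite leUx yx sx /= -[X in X <= _]join_primes_below.
  apply/joinsP => r Pr; have [->|rs] := eqVneq r s; first exact: leUr.
  by apply: lexUl; apply: joins_sup; rewrite /P Pr.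
- apply/joinsP => r /andP[rp rs]; apply: joins_sup.
  by rewrite /P rp (le_trans (ltW rs) sx) lt_eqF.
Qed.

End JoinPrimes.

(** * The global t-structure of a strict filtration *)

Section Restriction.
Variables (D : tricat) (A B : subcat D).
Hypothesis AB : subcat_le A B.

Lemma left_orth_restr (X : sub B) :
  left_orth (restr B A) X <-> left_orth A (sval X).
Proof.
split=> XA Y AY; last exact: XA.
exact: (XA (exist _ Y (AB AY))).
Qed.

Lemma right_orth_restr (X : sub B) :
  right_orth (restr B A) X <-> right_orth A (sval X).
Proof.
split=> XA Y AY; last exact: XA.
exact: (XA (exist _ Y (AB AY))).
Qed.

Lemma restr_left : left_admissible A -> forall X : sub B,
  exists X0 Y : sub B,
  [/\ tri X0 X Y, left_orth (restr B A) X0 & restr B A Y].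
Proof.
move=> /left_admissible_tri lA X; have [X0 [Y [XYZ X0A AY]]] := lA (sval X).
have BY := AB AY; have BX0 := sub_tri1 XYZ (svalP X) BY.
exists (exist _ X0 BX0), (exist _ Y BY); split=> //.
exact/left_orth_restr.
Qed.

Lemma restr_right : right_admissible A -> forall X : sub B,
  exists Y X0 : sub B,
  [/\ tri Y X X0, restr B A Y & right_orth (restr B A) X0].
Proof.
move=> /right_admissible_tri rA X; have [Y [X0 [XYZ AY X0A]]] := rA (sval X).
have BY := AB AY; have BX0 := sub_tri3 XYZ BY (svalP X).
exists (exist _ Y BY), (exist _ X0 BX0); split=> //.
exact/right_orth_restr.
Qed.

End Restriction.

Lemma left_orth_le (D : tricat) (A B : subcat D) (X : D) :
  subcat_le A B -> left_orth B X -> left_orth A X.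
Proof. by move=> AB XB Y /AB; apply: XB. Qed.

Lemma right_orth_le (D : tricat) (A B : subcat D) (X : D) :
  subcat_le A B -> right_orth B X -> right_orth A X.
Proof. by move=> AB XB Y /AB; apply: XB. Qed.

Section StrictFiltration.
Context {disp : Order.disp_t} {L : finTBDistrLatticeType disp}.
Variables (D : tricat) (F : L -> subcat D).
Hypothesis hF : admissible_filtration F.
Hypothesis hstrict : strict_filtration F.
Implicit Types (I J K M : L) (X Y Z : D).

Lemma fil_mono I J : I <= J -> subcat_le (F I) (F J).
Proof. exact: rfil_mono (proj2 hF) _ _. Qed.

Lemma fil_ladm I : left_admissible (F I).
Proof. exact: lfil_adm (proj1 hF) I. Qed.

Lemma fil_radm I : right_admissible (F I).
Proof. exact: rfil_adm (proj2 hF) I. Qed.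

Lemma fquot_left J M : J <= M -> forall X : sub (F M),
  exists X0 Y : sub (F M), [/\ tri X0 X Y,
    left_orth (restr (F M) (F J)) X0 & restr (F M) (F J) Y].
Proof. by move=> /fil_mono JM; apply: restr_left JM (fil_ladm J). Qed.

Lemma fquot_right J M : J <= M -> forall X : sub (F M),
  exists Y X0 : sub (F M), [/\ tri Y X X0,
    restr (F M) (F J) Y & right_orth (restr (F M) (F J)) X0].
Proof. by move=> /fil_mono JM; apply: restr_right JM (fil_radm J). Qed.

(** Orthogonality to the meet makes Hom(X, Z) the same in D and in the quotient, where strictness
    kills it. *)
Lemma strict_left_orth I J X :
  F J X -> left_orth (F (J `&` I)) X -> left_orth (F I) X.
Proof.
move=> JX XJI Z IZ; have XM := fil_mono (leUl J I) JX.
have ZM := fil_mono (leUr I J) IZ.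
pose X1 : sub (F (J `|` I)) := exist _ X XM.
pose Z1 : sub (F (J `|` I)) := exist _ Z ZM.
have XZ : @hom0 (fquot F (J `&` I) (J `|` I)) X1 Z1 by apply: hstrict.
have X1JI : left_orth (restr (F (J `|` I)) (F (J `&` I))) X1.
  by move=> Y; apply: XJI.
exact: (proj1 (verdier_hom0_left Z1 X1JI) XZ).
Qed.

Lemma strict_right_orth I J X :
  F J X -> right_orth (F (J `&` I)) X -> right_orth (F I) X.
Proof.
move=> JX XJI Z IZ; have XM := fil_mono (leUr J I) JX.
have ZM := fil_mono (leUl I J) IZ.
pose X1 : sub (F (I `|` J)) := exist _ X XM.
pose Z1 : sub (F (I `|` J)) := exist _ Z ZM.
have ZX : @hom0 (fquot F (I `&` J) (I `|` J)) Z1 X1 by apply: hstrict.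
have X1JI : right_orth (restr (F (I `|` J)) (F (I `&` J))) X1.
  by move=> Y; rewrite meetC => JIY; apply: XJI.
exact: (proj1 (verdier_hom0_right Z1 X1JI) ZX).
Qed.

(** The part X0 of X left orthogonal to F_J is zero. Indeed X1 is left orthogonal to the meet, hence
    to F_K by strictness, so X0 is orthogonal to F_K and F_J, thus to the subcategory of the join,
    in which it lies. *)
Lemma join_left_orth K J X : F (K `|` J) X -> left_orth (F K) X -> F J X.
Proof.
move=> KJX XK.
have [X0 [X1 [XXX X0J JX1]]] := left_admissible_tri (fil_ladm J) X.
have X1K : left_orth (F K) X1.
  apply: (strict_left_orth JX1); apply: (left_orth_tri3 XXX).
    exact: left_orth_le (fil_mono (leIl J K)) X0J.
  exact: left_orth_le (fil_mono (leIr K J)) XK.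
have X0K : left_orth (F K) X0 by apply: left_orth_tri1 XXX XK X1K.
have X0KJ : left_orth (F (K `|` J)) X0 by apply/(lfil_join (proj1 hF)).
have KJX0 : F (K `|` J) X0.
  exact: sub_tri1 XXX KJX (fil_mono (leUr J K) JX1).
apply: (sub_tri2 XXX) => //; apply/sub_zero/zero_objectP.
exact: X0KJ.
Qed.

Lemma join_right_orth K J X : F (K `|` J) X -> right_orth (F K) X -> F J X.
Proof.
move=> KJX XK.
have [X1 [X0 [XXX JX1 X0J]]] := right_admissible_tri (fil_radm J) X.
have X1K : right_orth (F K) X1.
  apply: (strict_right_orth JX1); apply: (right_orth_tri1 XXX).
    exact: right_orth_le (fil_mono (leIr K J)) XK.
  exact: right_orth_le (fil_mono (leIl J K)) X0J.
have X0K : right_orth (F K) X0 by apply: right_orth_tri3 XXX X1K XK.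
have X0KJ : right_orth (F (K `|` J)) X0 by apply/(rfil_join (proj2 hF)).
have KJX0 : F (K `|` J) X0.
  exact: sub_tri3 XXX (fil_mono (leUr J K) JX1) KJX.
apply: (sub_tri2 XXX) => //; apply/sub_zero/zero_objectP.
exact: X0KJ.
Qed.

Variable tau : forall s : L,
  join_prime s -> t_structure (fquot F (join_lt s) s).

(* The images of the aisle and of the coaisle of the stratum of s under j_! and
   j_*. *)
Definition stratum_le s X : Prop := exists (hs : join_prime s) (hX : F s X),
  le0 (tau hs) (exist _ X hX) /\ left_orth (F (join_lt s)) X.

Definition stratum_ge s X : Prop := exists (hs : join_prime s) (hX : F s X),
  ge1 (tau hs) (exist _ X hX) /\ right_orth (F (join_lt s)) X.

Lemma stratum_le_shift s X : stratum_le s X -> stratum_le s (shift X).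
Proof.
case=> hs [hX [leX Xo]].
exists hs, (proj1 (sub_shift (F s) X) (svalP (exist (F s) X hX))).
by split; [apply: (le0_shift leX) | apply/left_orth_shift].
Qed.

Lemma stratum_ge_shift s X : stratum_ge s (shift X) -> stratum_ge s X.
Proof.
case=> hs [hX [geX Xo]]; exists hs, (sub_unshift hX).
split; last exact/right_orth_shift.
apply: ge1_shift; apply: ge1_iso geX.
by apply: verdier_isoT; exists (idm (shift X)); apply: is_iso_id.
Qed.

(** * The given t-structure of one stratum, expressed by Hom in D *)

Section Stratum.
Variable s : L.
Hypothesis hs : join_prime s.
Let N := restr (F s) (F (join_lt s)).
Let s_left := fquot_left (join_lt_le s).
Let s_right := fquot_right (join_lt_le s).

(** By [le0P] the aisle is tested on the coaisle. Each coaisle object is isomorphic in the quotient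
    to one right orthogonal to the lower part, into which Hom is computed in D. *)
Lemma stratum_leE (X : sub (F s)) : le0 (tau hs) X <->
  forall B, stratum_ge s B -> hom0 (sval X) B.
Proof.
have lo := left_orth_restr (fil_mono (join_lt_le s)).
have ro := right_orth_restr (fil_mono (join_lt_le s)).
split=> [leX B [hs' [hB [geB Bo]]]|XB].
  have Bo' : right_orth N (exist _ B hB) by apply/ro.
  apply: (proj1 (verdier_hom0_right X Bo')).
  (* [stratum_ge] carries its own proof that s is join-prime. *)
  by apply: t_hom0 geB; rewrite (bool_irrelevance hs' hs).
apply: (proj2 (le0P s_left (tau hs) X)) => B geB.
have [P [[B0 sB0] [PBB0 NP B0N]]] := s_right B.
have BB0 := verdier_iso23 PBB0 NP.
apply: (hom0_isor (isomorphic_sym BB0)).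
apply/(verdier_hom0_right _ B0N)/XB; exists hs, sB0.
by split; [apply: ge1_iso BB0 geB | apply: (proj1 (ro _) B0N)].
Qed.

Lemma stratum_geE (X : sub (F s)) : ge1 (tau hs) X <->
  forall A, stratum_le s A -> hom0 A (sval X).
Proof.
have lo := left_orth_restr (fil_mono (join_lt_le s)).
have ro := right_orth_restr (fil_mono (join_lt_le s)).
split=> [geX A [hs' [hA [leA Ao]]]|AX].
  have Ao' : left_orth N (exist _ A hA) by apply/lo.
  apply: (proj1 (verdier_hom0_left X Ao')).
  by apply: t_hom0 geX; rewrite (bool_irrelevance hs hs').
apply: (proj2 (ge1P s_left s_right (tau hs) X)) => A leA.
have [[A0 sA0] [P [A0AP A0N NP]]] := s_left A.
have A0A := verdier_iso12 A0AP NP.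
apply: (hom0_isol A0A).
apply/(verdier_hom0_left _ A0N)/AX; exists hs, sA0.
by split; [apply: le0_iso (isomorphic_sym A0A) leA | apply: (proj1 (lo _) A0N)].
Qed.

(** Y need not be left orthogonal to the lower part, so its place in the aisle is recorded through
    Hom rather than by [stratum_le]. *)
Lemma stratum_truncation X : F s X -> exists Y B,
  [/\ tri Y X B, F s Y, stratum_ge s B &
      forall B', stratum_ge s B' -> hom0 Y B'].
Proof.
move=> hX; have ro := right_orth_restr (fil_mono (join_lt_le s)).
have [Y [[B sB] [YXB leY geB BN]]] :=
  lift_truncation_right s_left s_right (tau hs) (exist _ X hX).
exists (sval Y), B; split=> //; first exact: svalP Y.
  by exists hs, sB; split=> //; apply: (proj1 (ro _) BN).
exact/stratum_leE.
Qed.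

End Stratum.

Lemma stratum_le_in s X : stratum_le s X -> F s X.
Proof. by case=> hs []. Qed.

Lemma stratum_ge_in s X : stratum_ge s X -> F s X.
Proof. by case=> hs []. Qed.

(** The meet of J and s is strictly below s, hence below [join_lt s], and strictness extends the
    orthogonality from there to F_J. *)
Lemma stratum_le_left_orth s J X :
  ~~ (s <= J) -> stratum_le s X -> left_orth (F J) X.
Proof.
move=> sJ [hs [hX [_ Xo]]]; apply: (strict_left_orth hX).
by rewrite meetC; apply: left_orth_le (fil_mono (meet_le_join_lt sJ)) Xo.
Qed.

Lemma stratum_ge_right_orth s J X :
  ~~ (s <= J) -> stratum_ge s X -> right_orth (F J) X.
Proof.
move=> sJ [hs [hX [_ Xo]]]; apply: (strict_right_orth hX).
by rewrite meetC; apply: right_orth_le (fil_mono (meet_le_join_lt sJ)) Xo.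
Qed.

(** For s different from r, one object is orthogonal to the subcategory containing the other; for s
    = r it is the orthogonality in the stratum. *)
Lemma stratum_hom0 s r X Y : stratum_le s X -> stratum_ge r Y -> hom0 X Y.
Proof.
move=> leX geY; have [rs|rs] := boolP (r <= s); last first.
  exact: (stratum_ge_right_orth rs geY (stratum_le_in leX)).
have [sr|sr] := boolP (s <= r); last first.
  exact: (stratum_le_left_orth sr leX (stratum_ge_in geY)).
have sEr : s = r by apply/le_anti; rewrite sr.
rewrite sEr in leX; have [hr [hX [leX' _]]] := leX.
exact: (proj1 (stratum_leE hr _) leX' _ geY).
Qed.

(** Aisle and coaisle on all of D, the case J = bottom, M = top of the intervals below. *)
Definition global_le X : Prop := forall s B, stratum_ge s B -> hom0 X B.
Definition global_ge Y : Prop := forall s A, stratum_le s A -> hom0 A Y.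

(** Induction on K with X in F_K. Writing K as the join of K' and s, the part X1 in F_K' stays in
    the aisle and falls under induction, while X0 lies in F_s by [join_left_orth] and belongs to
    [stratum_le s]. *)
Lemma global_hom0 X Y : global_le X -> global_ge Y -> hom0 X Y.
Proof.
have : F \top X by apply: (rfil_top (proj2 hF)).
elim/(@lt_wf_ind _ L): \top X => K IH X KX leX geY.
have [K0|K0] := eqVneq K \bot.
  by apply: zero_hom0l; apply/(rfil_bot (proj2 hF)); rewrite -K0.
have [s [K' [hs K'K K'sK sK' sNK']]] := join_prime_split K0.
have [X0 [X1 [XXX X0K' K'X1]]] := left_admissible_tri (fil_ladm K') X.
have leX1 : global_le X1.
  move=> r B geB; have [rK'|rK'] := boolP (r <= K'); last first.
    exact: (stratum_ge_right_orth rK' geB K'X1).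
  apply: (tri_hom0l (tri_rot XXX)); first exact: leX geB.
  apply: (proj2 (left_orth_shift (F K') X0) X0K').
  exact: fil_mono rK' _ (stratum_ge_in geB).
apply: (tri_hom0l XXX); last exact: IH K'K _ K'X1 leX1 geY.
have KX0 : F K X0 by apply: sub_tri1 XXX KX (fil_mono (ltW K'K) K'X1).
have sX0 : F s X0 by apply: join_left_orth X0K'; rewrite K'sK.
apply: (geY s); exists hs, sX0.
split; last exact: left_orth_le (fil_mono sK') X0K'.
apply/stratum_leE => B geB /=.
have BK' := stratum_ge_right_orth sNK' geB.
(* X0[1] is an extension of X[1] by X1, and B[1] receives no map from either. *)
apply/hom0_shift; apply: (tri_hom0l (tri_rot (tri_rot XXX))).
  exact: (proj2 (right_orth_shift (F K') B) BK').
by apply/hom0_shift/leX/geB.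
Qed.

Lemma global_truncation K X : F K X -> exists A B,
  [/\ tri A X B, F K A /\ F K B, global_le A & global_ge B].
Proof.
elim/(@lt_wf_ind _ L): K X => K IH X KX.
have [K0|K0] := eqVneq K \bot.
  have X0 : zero_object X by apply/(rfil_bot (proj2 hF)); rewrite -K0.
  exists X, X; split=> //.
  - exists (idm X), 0%R, 0%R; exact: dist_id (tricP D) _ _ X0.
  - by move=> s B _; apply: zero_hom0l.
  - by move=> s A _; apply: zero_hom0r.
have [s [K' [hs K'K K'sK sK' sNK']]] := join_prime_split K0.
have sK : s <= K by rewrite -K'sK leUr.
have mK' := fil_mono (ltW K'K).
(* The part P in F_K' is split off; the rest X' lies in F_s and is truncated in the stratum s. *)
have [P [X' [PXX' K'P X'K']]] := right_admissible_tri (fil_radm K') X.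
have KX' : F K X' by apply: sub_tri3 PXX' (mK' _ K'P) KX.
have sX' : F s X' by apply: join_right_orth X'K'; rewrite K'sK.
have [A' [B1 [A'X'B1 sA' geB1 leA']]] := stratum_truncation hs sX'.
have [p [q [pq PXX'd]]] := PXX'; have [a [b [ab A'd]]] := A'X'B1.
(* Y, the fibre of X -> B1, is an extension of A' by P, neither of which maps to [stratum_ge s]. *)
have [Y [[y [y' Yd]] PYA']] := tri_fiber PXX'd A'd.
have leY B : stratum_ge s B -> hom0 Y B.
  move=> geB; apply: (tri_hom0l PYA'); last exact: leA'.
  exact: (stratum_ge_right_orth sNK' geB K'P).
have KB1 : F K B1 := fil_mono sK (stratum_ge_in geB1).
have KY : F K Y := sub_tri1 (dist_tri Yd) KX KB1.
(* The part of Y in F_K', now on the other side, is truncated by induction. *)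
have [Y0 [Y1 [Y0YY1 Y0K' K'Y1]]] := left_admissible_tri (fil_ladm K') Y.
have [A1 [B2 [A1Y1B2 [K'A1 K'B2] leA1 geB2]]] := IH _ K'K _ K'Y1.
have [c [d [e Y0d]]] := Y0YY1; have [k [l [m A1d]]] := A1Y1B2.
(* A is the fibre of Y -> B2 and B the cone of A -> X: A is built from Y0 and A1, and B from B2 and
   B1. *)
have [A [[z [z' Ad]] Y0AA1]] := tri_fiber Y0d A1d.
have [B [AXB B2BB1]] := tri_comp Ad Yd.
have KY0 : F K Y0 := sub_tri1 Y0YY1 KY (mK' _ K'Y1).
exists A, B; split=> //.
- split; first exact: sub_tri2 Y0AA1 KY0 (mK' _ K'A1).
  exact: sub_tri2 B2BB1 (mK' _ K'B2) KB1.
- move=> r C geC; apply: (tri_hom0l Y0AA1); last exact: leA1 geC.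
  have [rK|rK] := boolP (r <= K); last first.
    exact: (stratum_ge_right_orth rK geC KY0).
  have [rK'|rK'] := boolP (r <= K').
    exact: Y0K' (fil_mono rK' (stratum_ge_in geC)).
  (* A join-prime below K but not below K' is s, because everything strictly below s is below K'.
     For s, Hom(Y0, C) lies between Hom(Y, C) and Hom(Y1, C[1]), both zero. *)
  have hr : join_prime r by case: geC.
  have rs : r <= s.
    by move: rK; rewrite -K'sK => /(join_primeP hr); rewrite (negPf rK').
  have rEs : r = s.
    apply/eqP; rewrite eq_le rs /=; apply: contraNT rK' => sr.
    apply: le_trans sK'; apply: join_prime_lt_join_lt => //.
    by rewrite lt_neqAle rs andbT; apply: contraNneq sr => ->.
  rewrite {}rEs in geC; have CK' := stratum_ge_right_orth sNK' geC.
  apply/hom0_shift; apply: (tri_hom0l (tri_rot (tri_rot Y0YY1))).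
    exact: (proj2 (right_orth_shift (F K') C) CK').
  by apply/hom0_shift/leY.
- move=> r C leC; apply: (tri_hom0r B2BB1); first exact: geB2 leC.
  exact: stratum_hom0 leC geB1.
Qed.

End StrictFiltration.

(** * Recollements of Verdier quotients *)

Definition op (C : category) : category := @Category C
  (fun X Y => @Hom C Y X) (fun X => idm X) (fun X Y Z g f => f ∘ g)
  (fun X Y Z W h g f => esym (compA f g h))
  (fun X Y f => compmI f) (fun X Y f => compIm f).

Definition op_functor (C C' : category) (F : functor C C') :
    functor (op C) (op C') :=
  @Functor (op C) (op C') F (fun X Y f => fmap F f)
    (fun X => fmap_id F X) (fun X Y Z g f => fmap_comp F f g).

Lemma left_adjoint_exists (C C' : category) (G : functor C' C) :
  (forall X : C, exists (Y : C') (u : Hom X (G Y)), forall Z : C',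
     bijective (fun f : Hom Y Z => fmap G f ∘ u)) ->
  exists (F : functor C C') (eta : forall X, Hom X (G (F X))),
    (forall X X' (f : Hom X X'), fmap G (fmap F f) ∘ eta X = eta X' ∘ f) /\
    forall X Z, bijective (fun f : Hom (F X) Z => fmap G f ∘ eta X).
Proof.
move=> univ; pose F0 X := projT1 (cid (univ X)).
pose eta X : Hom X (G (F0 X)) := projT1 (cid (projT2 (cid (univ X)))).
have etaB X Z : bijective (fun f : Hom (F0 X) Z => fmap G f ∘ eta X).
  exact: (projT2 (cid (projT2 (cid (univ X))))).
pose F1 X Y (f : Hom X Y) : Hom (F0 X) (F0 Y) :=
  projT1 (cid (bij_surj (etaB X (F0 Y)) (eta Y ∘ f))).
have F1E X Y (f : Hom X Y) : fmap G (F1 _ _ f) ∘ eta X = eta Y ∘ f.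
  by rewrite /F1; case: cid.
have F1id X : F1 _ _ (idm X) = idm (F0 X).
  by apply: (bij_inj (etaB _ _)); rewrite F1E fmap_id compIm compmI.
have F1comp X Y Z (g : Hom Y Z) (f : Hom X Y) :
    F1 _ _ (g ∘ f) = F1 _ _ g ∘ F1 _ _ f.
  apply: (bij_inj (etaB _ _)).
  by rewrite F1E fmap_comp -compA F1E !compA F1E.
by exists (Functor F1id F1comp), eta.
Qed.

Lemma universal_adjoint (C C' : category) (F : functor C C')
    (G : functor C' C) (eta : forall X, Hom X (G (F X))) :
  (forall X X' (f : Hom X X'), fmap G (fmap F f) ∘ eta X = eta X' ∘ f) ->
  (forall X Z, bijective (fun f : Hom (F X) Z => fmap G f ∘ eta X)) ->
  adjoint F G.
Proof.
move=> nat etaB; exists (fun X Y f => fmap G f ∘ eta X); split=> //.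
  by move=> X X' Y u f; rewrite fmap_comp -compA nat compA.
by move=> X Y Y' v f; rewrite fmap_comp compA.
Qed.

Lemma universal_ff (C C' : category) (F : functor C C')
    (G : functor C' C) (eta : forall X, Hom X (G (F X))) :
  (forall X X' (f : Hom X X'), fmap G (fmap F f) ∘ eta X = eta X' ∘ f) ->
  (forall X Z, bijective (fun f : Hom (F X) Z => fmap G f ∘ eta X)) ->
  (forall X, is_iso (eta X)) -> fully_faithful F.
Proof.
move=> nat etaB etaI X Y; apply: bijP => [f g fg|g].
  by apply: (iso_mono (etaI Y)); rewrite -!nat fg.
have [f fE] := bij_surj (iso_comp_bij X (etaI Y)) (fmap G g ∘ eta X).
by exists f; apply: (bij_inj (etaB X (F Y))); rewrite nat fE.
Qed.

Lemma left_adjoint_universal (C C' : category) (G : functor C' C) :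
  (forall X : C, exists (Y : C') (u : Hom X (G Y)), forall Z : C',
     bijective (fun f : Hom Y Z => fmap G f ∘ u)) ->
  exists F : functor C C', adjoint F G.
Proof.
move=> /left_adjoint_exists[F [eta [nat etaB]]].
by exists F; apply: universal_adjoint nat etaB.
Qed.

Lemma left_adjoint_ff (C C' : category) (G : functor C' C) :
  (forall X : C, exists (Y : C') (u : Hom X (G Y)), is_iso u /\
     forall Z : C', bijective (fun f : Hom Y Z => fmap G f ∘ u)) ->
  exists F : functor C C', adjoint F G /\ fully_faithful F.
Proof.
move=> univ; have [|F [eta [nat etaB]]] := @left_adjoint_exists _ _ G.
  by move=> X; have [Y [u [_ uB]]] := univ X; exists Y, u.
exists F; split; first exact: universal_adjoint nat etaB.
apply: (universal_ff nat etaB) => X.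
have [Y [u [ui uB]]] := univ X.
(* [eta X] was chosen independently of [u]; two universal arrows differ by an isomorphism, so
   [eta X] is invertible too. *)
have [v vE] := bij_surj (uB (F X)) (eta X).
have [w wE] := bij_surj (etaB X Y) u.
rewrite -vE; apply: is_iso_comp => //; apply: is_iso_fmap.
exists w; split.
  by apply: (bij_inj (uB Y)); rewrite /= fmap_comp fmap_id -compA vE wE compIm.
apply: (bij_inj (etaB X (F X))).
by rewrite /= fmap_comp fmap_id -compA wE vE compIm.
Qed.

(** Right adjoints are obtained from left adjoints of opposite functors. Passing to opposites
    reverses the adjunction bijection, so its inverse [psi] is used. *)
Lemma right_adjoint_op (C C' : category) (F : functor C C') :
  forall H : functor (op C') (op C), adjoint H (op_functor F) ->
  exists G : functor C' C, adjoint F G /\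
    (fully_faithful H -> fully_faithful G).
Proof.
move=> H [phi [phiB phil phir]].
pose G : functor C' C := @Functor C' C H
  (fun X Y f => fmap H (f : @Hom (op C') Y X))
  (fun X => fmap_id H X) (fun X Y Z g f => @fmap_comp _ _ H Z Y X f g).
have phiS X Y : exists psi : Hom (F X) Y -> Hom X (G Y),
    cancel (phi Y X) psi /\ cancel psi (phi Y X).
  by case: (phiB Y X) => psi; exists psi.
pose psi X Y := projT1 (cid (phiS X Y)).
have psiK X Y : cancel (phi Y X) (psi X Y).
  by rewrite /psi; case: cid => ? [].
have phiK X Y : cancel (psi X Y) (phi Y X).
  by rewrite /psi; case: cid => ? [].
exists G; split; last by move=> ffH X Y; apply: (ffH Y X).
exists psi; split.
- by move=> X Y; exact: (Bijective (phiK X Y) (psiK X Y)).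
- move=> X X' Y u f; apply: (can_inj (psiK X' Y)); rewrite phiK.
  by have := phir Y X X' u (psi X Y f); rewrite /= phiK => ->.
- move=> X Y Y' v f; apply: (can_inj (psiK X Y')); rewrite phiK.
  by have := phil Y Y' X v (psi X Y f); rewrite /= phiK => ->.
Qed.

Lemma right_adjoint_universal (C C' : category) (F : functor C C') :
  (forall Y : C', exists (X : C) (u : Hom (F X) Y), forall Z : C,
     bijective (fun f : Hom Z X => u ∘ fmap F f)) ->
  exists G : functor C' C, adjoint F G.
Proof.
move=> univ.
have [H HF] := @left_adjoint_universal (op C') (op C) (op_functor F) univ.
by have [G [FG _]] := right_adjoint_op HF; exists G.
Qed.

Lemma right_adjoint_ff (C C' : category) (F : functor C C') :
  (forall Y : C', exists (X : C) (u : Hom (F X) Y), is_iso u /\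
     forall Z : C, bijective (fun f : Hom Z X => u ∘ fmap F f)) ->
  exists G : functor C' C, adjoint F G /\ fully_faithful G.
Proof.
move=> univ.
have [|H [HF Hff]] := @left_adjoint_ff (op C') (op C) (op_functor F).
  move=> Y; have [X [u [[v [vu uv]] uB]]] := univ Y.
  by exists X, u; split=> //; exists v.
by have [G [FG Gff]] := right_adjoint_op HF; exists G; split; last exact: Gff.
Qed.

Lemma adjoint_hom0 (C C' : category) (F : functor C C') (G : functor C' C)
    (X : C) (Y : C') :
  adjoint F G -> (hom0 (F X) Y <-> hom0 X (G Y)).
Proof.
case=> phi [phiB _ _]; split=> XY f g.
  have [f' <-] := bij_surj (phiB X Y) f; have [g' <-] := bij_surj (phiB X Y) g.
  by rewrite (XY f' g').
by apply: (bij_inj (phiB X Y)); apply: XY.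
Qed.

Lemma ff_hom0 (C C' : category) (F : functor C C') (X Y : C) :
  fully_faithful F -> hom0 X Y -> hom0 (F X) (F Y).
Proof.
move=> ff XY f g; have [f' <-] := bij_surj (ff X Y) f.
by have [g' <-] := bij_surj (ff X Y) g; rewrite (XY f' g').
Qed.

Lemma t_structure_ext (T : tridata) (t t' : t_structure T) :
  (forall X, le0 t X <-> le0 t' X) -> (forall X, ge1 t X <-> ge1 t' X) ->
  t = t'.
Proof.
case: t => le ge li gi ls gs th tt; case: t' => le' ge' li' gi' ls' gs' th' tt'.
move=> /= leE geE.
have E1 : le = le' by apply/funext => X; apply/propext.
have E2 : ge = ge' by apply/funext => X; apply/propext.
subst le' ge'; congr TStructure; exact: Prop_irrelevance.
Qed.

Lemma bij_square (X X' Y Y' : Type) (h : X -> Y) (h' : X' -> Y')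
    (a : X -> X') (b : Y -> Y') :
  bijective a -> bijective b -> (forall x, b (h x) = h' (a x)) ->
  bijective h <-> bijective h'.
Proof.
move=> aB bB bh; have [a' aK a'K] := aB; have [b' bK b'K] := bB.
have b'B : bijective b' by exists b.
have a'B : bijective a' by exists a.
split=> hB.
  apply: (eq_bij (f := b \o h \o a')).
    exact: bij_comp (bij_comp bB hB) a'B.
  by move=> x /=; rewrite bh a'K.
apply: (eq_bij (f := b' \o h' \o a)).
  exact: bij_comp (bij_comp b'B hB) aB.
by move=> x /=; rewrite -bh bK.
Qed.

(** * The recollement of C/A with respect to B/A, for A in B in C *)

Section Recollement.
Variables (D : tricat) (A B C : subcat D).
Hypotheses (AB : subcat_le A B) (BC : subcat_le B C).
Hypotheses (A_left : left_admissible A) (A_right : right_admissible A).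
Hypotheses (B_left : left_admissible B) (B_right : right_admissible B).
Local Notation QB := (verdier (restr B A)).
Local Notation QC := (verdier (restr C A)).
Local Notation QQ := (verdier (restr C B)).
Local Notation locB := (loc_mor (cone_in (restr B A))).
Local Notation locC := (loc_mor (cone_in (restr C A))).
Local Notation locQ := (loc_mor (cone_in (restr C B))).

Hypothesis incl_cone : forall (X Y : sub B) (s : Hom X Y),
  cone_in (restr B A) s -> cone_in (restr C A) (fmap (sub_incl BC) s).
Hypothesis quot_cone : forall (X Y : sub C) (s : Hom X Y),
  cone_in (restr C A) s ->
  cone_in (restr C B) (fmap (id_functor (sub C)) s).
Let i : functor QB QC := loc_map incl_cone.
Let j : functor QC QQ := loc_map quot_cone.
Let AC : subcat_le A C := fun X AX => BC (AB AX).

Lemma fmap_incl_loc (X Y : sub B) (f : Hom X Y) :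
  fmap i (locB f) = locC (fmap (sub_incl BC) f).
Proof. exact: loc_map_morE. Qed.

Lemma fmap_quot_loc (X Y : sub C) (f : Hom X Y) : fmap j (locC f) = locQ f.
Proof. exact: loc_map_morE. Qed.

(** Z is replaced by a Z' right orthogonal to A and isomorphic to it in the quotient. Maps into Z'
    are unchanged by both quotients, so universality descends from the inclusion of B in C. *)
Lemma incl_left_universal (X : sub C) (Y : sub B)
    (g : Hom X (sub_incl BC Y)) :
  (forall Z : sub B, bijective (fun f : Hom Y Z => fmap (sub_incl BC) f ∘ g)) ->
  forall Z : QB, bijective (fun f : @Hom QB Y Z => fmap i f ∘ locC g).
Proof.
move=> gB Z; have [P [Z' [[p [z [q pzq]]] AP Z'A]]] := restr_right AB A_right Z.
have zi : is_iso (locB z : @Hom QB Z Z').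
  apply: loc_mor_iso; exists (shift P), q, (- fmap shift p)%R.
  split; first exact: (proj1 (dist_rot (tricP (sub B)) _ _ _) pzq).
  exact: (proj1 (sub_shift (restr B A) P)).
pose h (W : QB) (f : @Hom QB Y W) : @Hom QC X (i W) := fmap i f ∘ locC g.
apply: (proj2 (@bij_square _ _ _ _ (@h Z) (@h Z') _ _
  (@iso_comp_bij QB Y _ _ _ zi)
  (@iso_comp_bij QC X _ _ _ (is_iso_fmap i zi)) _)).
  by move=> f; rewrite /h fmap_comp compA.
have iZ'A : right_orth (restr C A) (sub_incl BC Z').
  by apply/(right_orth_restr AC); move/(right_orth_restr AB): Z'A.
apply: (proj1 (@bij_square _ _ _ _ _ (@h Z') _ _ (verdier_right_bij Y Z'A)
  (verdier_right_bij X iZ'A) _) (gB Z')) => f.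
by rewrite /h fmap_incl_loc -loc_mor_comp.
Qed.

Lemma incl_right_universal (Y : sub C) (X : sub B)
    (g : Hom (sub_incl BC X) Y) :
  (forall Z : sub B, bijective (fun f : Hom Z X => g ∘ fmap (sub_incl BC) f)) ->
  forall Z : QB, bijective (fun f : @Hom QB Z X => locC g ∘ fmap i f).
Proof.
move=> gB Z; have [Z' [P [[z [p [q zpq]]] Z'A AP]]] := restr_left AB A_left Z.
have zi : is_iso (locB z : @Hom QB Z' Z).
  by apply: loc_mor_iso; exists P, p, q.
pose h (W : QB) (f : @Hom QB W X) : @Hom QC (i W) Y := locC g ∘ fmap i f.
apply: (proj2 (@bij_square _ _ _ _ (@h Z) (@h Z') _ _
  (@comp_iso_bij QB _ _ X _ zi)
  (@comp_iso_bij QC _ _ Y _ (is_iso_fmap i zi)) _)).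
  by move=> f; rewrite /h fmap_comp compA.
have iZ'A : left_orth (restr C A) (sub_incl BC Z').
  by apply/(left_orth_restr AC); move/(left_orth_restr AB): Z'A.
apply: (proj1 (@bij_square _ _ _ _ _ (@h Z') _ _ (verdier_left_bij X Z'A)
  (verdier_left_bij Y iZ'A) _) (gB Z')) => f.
by rewrite /h fmap_incl_loc -loc_mor_comp.
Qed.

(** Full faithfulness is the universality of an identity arrow. *)
Lemma incl_ff : fully_faithful i.
Proof.
move=> X Y.
have := @incl_left_universal (sub_incl BC X) X (idm _) _ Y.
rewrite loc_mor_id => /(_ _)/eq_bij; apply=> [Z|f]; last exact: compmI.
by apply: (eq_bij (f := id)); [exists id | move=> f; rewrite compmI].
Qed.

Lemma incl_left_adjoint : exists G : functor QC QB, adjoint G i.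
Proof.
apply: left_adjoint_universal => X.
have [Y [e [BY eS eI]]] := left_admissible_arrow B_left (sval X).
exists (exist _ Y BY), (locC (e : @Hom (sub C) X (sub_incl BC (exist _ Y BY)))).
apply: incl_left_universal => Z; apply: bijP => [f g fg|f].
  apply/eqP; rewrite -subr_eq0; apply/eqP; apply: (eI (sval Z)).
    exact: svalP.
  by rewrite (compDl (tricP D)) compNm; apply/eqP; rewrite subr_eq0; apply/eqP.
exact: eS (svalP Z).
Qed.

Lemma incl_right_adjoint : exists G : functor QC QB, adjoint i G.
Proof.
apply: right_adjoint_universal => X.
have [Y [e [BY eS eI]]] := right_admissible_arrow B_right (sval X).
exists (exist _ Y BY), (locC (e : @Hom (sub C) (sub_incl BC (exist _ Y BY)) X)).
apply: incl_right_universal => Z; apply: bijP => [f g fg|f].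
  apply/eqP; rewrite -subr_eq0; apply/eqP; apply: (eI (sval Z)).
    exact: svalP.
  by rewrite (compDr (tricP D)) compmN; apply/eqP; rewrite subr_eq0; apply/eqP.
exact: eS (svalP Z).
Qed.

(** The adjoint sends X to its part X0 left orthogonal to B. Being left orthogonal to A as well, X0
    has the same maps to Z in C, C/A and C/B. *)
Lemma quot_left_adjoint :
  exists G : functor QQ QC, adjoint G j /\ fully_faithful G.
Proof.
apply: left_adjoint_ff => X.
have [X0 [P [[x [p [q xpq]]] X0B BP]]] := restr_left BC B_left X.
have xi : is_iso (locQ x : @Hom QQ X0 X) by apply: loc_mor_iso; exists P, p, q.
have X0A : left_orth (restr C A) X0.
  by apply/(left_orth_restr AC)/(left_orth_le AB)/(left_orth_restr BC).
have [y [yx xy]] := xi; have yi : is_iso y by exists (locQ x).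
exists X0, y; split=> // Z.
have idB : bijective (@id (Hom X0 Z)) by exists id.
have jB : bijective (fun f : @Hom QC X0 Z => fmap j f).
  apply: (proj1 (@bij_square _ _ _ _ id (fun f : @Hom QC X0 Z => fmap j f)
    _ _ (verdier_left_bij Z X0A)
    (verdier_left_bij Z X0B) _) idB) => f.
  by rewrite fmap_quot_loc.
exact: (bij_comp (@comp_iso_bij QQ _ _ Z _ yi) jB).
Qed.

Lemma quot_right_adjoint :
  exists G : functor QQ QC, adjoint j G /\ fully_faithful G.
Proof.
apply: right_adjoint_ff => X.
have [P [X0 [[p [x [q pxq]]] BP X0B]]] := restr_right BC B_right X.
have xi : is_iso (locQ x : @Hom QQ X X0).
  apply: loc_mor_iso; exists (shift P), q, (- fmap shift p)%R.
  split; first exact: (proj1 (dist_rot (tricP (sub C)) _ _ _) pxq).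
  exact: (proj1 (sub_shift (restr C B) P)).
have X0A : right_orth (restr C A) X0.
  by apply/(right_orth_restr AC)/(right_orth_le AB)/(right_orth_restr BC).
have [y [yx xy]] := xi; have yi : is_iso y by exists (locQ x).
exists X0, y; split=> // Z.
have idB : bijective (@id (@Hom (sub C) Z X0)) by exists id.
have jB : bijective (fun f : @Hom QC Z X0 => fmap j f).
  apply: (proj1 (@bij_square _ _ _ _ id (fun f : @Hom QC Z X0 => fmap j f)
    _ _ (verdier_right_bij Z X0A)
    (verdier_right_bij Z X0B) _) idB) => f.
  by rewrite fmap_quot_loc.
exact: (bij_comp (@iso_comp_bij QQ Z _ _ _ yi) jB).
Qed.

(** The adjoints are known only through existence statements in [Prop], so the recollement, which is
    data, is obtained under an existential. *)
Lemma verdier_recollement : exists r : recollement i j, True.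
Proof.
have [il ilP] := incl_left_adjoint; have [ir irP] := incl_right_adjoint.
have [jl [jlP jlff]] := quot_left_adjoint.
have [jr [jrP jrff]] := quot_right_adjoint.
by exists (Recollement ilP irP jlP jrP incl_ff jlff jrff).
Qed.

End Recollement.

(** * The system of t-structures *)

Section IntervalTStructures.
Context {disp : Order.disp_t} {L : finTBDistrLatticeType disp}.
Variables (D : tricat) (F : L -> subcat D).
Hypothesis hF : admissible_filtration F.
Hypothesis hstrict : strict_filtration F.
Variable tau : forall s : L,
  join_prime s -> t_structure (fquot F (join_lt s) s).
Local Notation sle := (@stratum_le _ _ _ _ tau).
Local Notation sge := (@stratum_ge _ _ _ _ tau).
Local Notation mono := (fil_mono hF).
Implicit Types (I J K M s : L).

Definition interval_le J M (X : sub (F M)) : Prop :=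
  forall s B, s <= M -> ~~ (s <= J) -> sge s B -> hom0 (sval X) B.

Definition interval_ge J M (X : sub (F M)) : Prop :=
  forall s A, s <= M -> ~~ (s <= J) -> sle s A -> hom0 A (sval X).

Lemma stratum_ge_iso s (X Y : D) : isomorphic X Y -> sge s X -> sge s Y.
Proof.
move=> XY [hs [hX [geX Xo]]]; have hY := sub_iso XY hX.
exists hs, hY; split; last by move=> Z AZ; apply: (hom0_isor XY); apply: Xo.
apply: ge1_iso geX; apply: verdier_isoT; exact: XY.
Qed.

Section Interval.
Variables J M : L.
Hypothesis JM : J <= M.
Local Notation Q := (fquot F J M).

Lemma interval_hom0_ge s (X Y : sub (F M)) : ~~ (s <= J) -> sge s (sval Y) ->
  @hom0 Q X Y <-> hom0 (sval X) (sval Y).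
Proof.
move=> sJ geY; apply: verdier_hom0_right.
exact/(right_orth_restr (mono JM))/(stratum_ge_right_orth hF hstrict sJ geY).
Qed.

Lemma interval_hom0_le s (X Y : sub (F M)) : ~~ (s <= J) -> sle s (sval X) ->
  @hom0 Q X Y <-> hom0 (sval X) (sval Y).
Proof.
move=> sJ leX; apply: verdier_hom0_left.
exact/(left_orth_restr (mono JM))/(stratum_le_left_orth hF hstrict sJ leX).
Qed.

Lemma interval_le_iso (X Y : Q) :
  isomorphic X Y -> interval_le J X -> interval_le J Y.
Proof.
move=> XY leX s B sM sJ geB; have MB := mono sM (stratum_ge_in geB).
pose B' : sub (F M) := exist _ B MB.
apply: (proj1 (@interval_hom0_ge s Y B' sJ geB)); apply: (hom0_isol XY).
exact: (proj2 (@interval_hom0_ge s X B' sJ geB) (leX _ _ sM sJ geB)).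
Qed.

Lemma interval_ge_iso (X Y : Q) :
  isomorphic X Y -> interval_ge J X -> interval_ge J Y.
Proof.
move=> XY geX s A sM sJ leA; have MA := mono sM (stratum_le_in leA).
pose A' : sub (F M) := exist _ A MA.
apply: (proj1 (@interval_hom0_le s A' Y sJ leA)); apply: (hom0_isor XY).
exact: (proj2 (@interval_hom0_le s A' X sJ leA) (geX _ _ sM sJ leA)).
Qed.

Lemma interval_le_shift (X : Q) : interval_le J X -> interval_le J (shift X).
Proof.
move=> leX s B sM sJ geB; have [B' B'B] := unshift B.
apply: (hom0_isor B'B); apply/hom0_shift; apply: leX sM sJ _.
exact/stratum_ge_shift/(stratum_ge_iso (isomorphic_sym B'B)).
Qed.

Lemma interval_ge_shift (X : Q) : interval_ge J (shift X) -> interval_ge J X.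
Proof.
move=> geX s A sM sJ leA; apply/hom0_shift.
by apply: geX sM sJ _; apply: stratum_le_shift.
Qed.

(** X and Y are replaced by parts left and right orthogonal to F_J. This supplies the conditions for
    s below J, and those for s not below M hold in F_M, so [global_hom0] applies. *)
Lemma interval_hom0 (X Y : Q) :
  interval_le J X -> interval_ge J Y -> hom0 X Y.
Proof.
move=> leX geY.
have [X0 [P [X0XP X0J JP]]] := fquot_left hF JM X.
have [P' [Y0 [PYY0 JP' Y0J]]] := fquot_right hF JM Y.
have X0X := verdier_iso12 X0XP JP; have YY0 := verdier_iso23 PYY0 JP'.
apply: (hom0_isol X0X); apply: (hom0_isor (isomorphic_sym YY0)).
apply/(verdier_hom0_left _ X0J)/(global_hom0 hF hstrict (tau := tau)).
  move=> s B geB; have [sM|sM] := boolP (s <= M); last first.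
    exact: (stratum_ge_right_orth hF hstrict sM geB (svalP X0)).
  have [sJ|sJ] := boolP (s <= J).
    apply: (proj1 (left_orth_restr (mono JM) X0) X0J).
    exact: mono sJ _ (stratum_ge_in geB).
  exact: (interval_le_iso (isomorphic_sym X0X) leX sM sJ geB).
move=> s A leA; have [sM|sM] := boolP (s <= M); last first.
  exact: (stratum_le_left_orth hF hstrict sM leA (svalP Y0)).
have [sJ|sJ] := boolP (s <= J).
  apply: (proj1 (right_orth_restr (mono JM) Y0) Y0J).
  exact: mono sJ _ (stratum_le_in leA).
exact: (interval_ge_iso YY0 geY sM sJ leA).
Qed.

Lemma interval_truncation (X : Q) : exists (A B : Q)
  (f : Hom A X) (g : Hom X B) (h : Hom B (shift A)),
  [/\ interval_le J A, interval_ge J B & dist f g h].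
Proof.
have [A [B [[f [g [h fgh]]] [MA MB] leA geB]]] :=
  global_truncation hF hstrict tau (svalP X).
pose A' : sub (F M) := exist _ A MA; pose B' : sub (F M) := exist _ B MB.
exists A', B'.
exists (loc_mor (cone_in (restr (F M) (F J))) (f : @Hom (sub (F M)) A' X)).
exists (loc_mor (cone_in (restr (F M) (F J))) (g : @Hom (sub (F M)) X B')).
exists (loc_mor (cone_in (restr (F M) (F J)))
  (h : @Hom (sub (F M)) B' (shift A'))).
split.
- by move=> s C _ _; apply: leA.
- by move=> s C _ _; apply: geB.
- exact: verdier_dist_loc.
Qed.

Definition interval_t : t_structure Q := TStructure
  interval_le_iso interval_ge_iso interval_le_shift interval_ge_shift
  interval_hom0 interval_truncation.

End Interval.

(** Only the stratum s contributes to the interval from [join_lt s] to s, which is why the given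
    t-structure is recovered there. *)
Lemma prime_interval s r :
  join_prime r -> r <= s -> ~~ (r <= join_lt s) -> r = s.
Proof.
move=> hr rs; apply: contraNeq => rNs; apply: join_prime_lt_join_lt => //.
by rewrite lt_neqAle rNs.
Qed.

Lemma interval_t_stratum s (hs : join_prime s) :
  interval_t (join_lt_le s) = tau hs.
Proof.
apply: t_structure_ext => X; split=> /=.
- move=> leX; apply/(stratum_leE hF) => B; apply: leX => //.
  exact: join_lt_lt.
- move=> /(stratum_leE hF) leX r B rs rNs geB.
  have hr : join_prime r by case: geB.
  by apply: leX; rewrite -(prime_interval hr rs rNs).
- move=> geX; apply/(stratum_geE hF) => A; apply: geX => //.
  exact: join_lt_lt.
- move=> /(stratum_geE hF) geX r A rs rNs leA.
  have hr : join_prime r by case: leA.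
  by apply: geX; rewrite -(prime_interval hr rs rNs).
Qed.

(** The join-primes of the interval are split by whether they lie below K. Those that do are moved
    to [F_K / F_J] by the adjunctions of [i_left] and [i_right]; the others are those of
    [F_M / F_K]. *)
Lemma interval_t_glued J K M (JK : J <= K) (KM : K <= M)
    (r : recollement (fquot_incl J (rfil_mono (proj2 hF) KM))
                     (fquot_quot M (rfil_mono (proj2 hF) JK))) :
  glued r (interval_t JK) (interval_t KM) (interval_t (le_trans JK KM)).
Proof.
have JM := le_trans JK KM.
have leK (X : sub (F M)) s B : s <= K -> ~~ (s <= J) -> sge s B ->
    hom0 (sval X) B <-> hom0 (sval (i_left r X)) B.
  move=> sK sJ geB; have KB := mono sK (stratum_ge_in geB).
  pose B' : fquot F J K := exist _ B KB.
  have h1 := interval_hom0_ge JK (i_left r X) (Y := B') sJ geB.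
  have h2 := interval_hom0_ge JM X
    (Y := fquot_incl J (rfil_mono (proj2 hF) KM) B') sJ geB.
  have h3 := @adjoint_hom0 (fquot F J M) (fquot F J K) _ _ X B' (i_left_adj r).
  by split=> [/h2/h3/h1|/h1/h3/h2].
have geK (X : sub (F M)) s A : s <= K -> ~~ (s <= J) -> sle s A ->
    hom0 A (sval X) <-> hom0 A (sval (i_right r X)).
  move=> sK sJ leA; have KA := mono sK (stratum_le_in leA).
  pose A' : fquot F J K := exist _ A KA.
  have h1 := interval_hom0_le JK (i_right r X) (X := A') sJ leA.
  have h2 := interval_hom0_le JM X
    (X := fquot_incl J (rfil_mono (proj2 hF) KM) A') sJ leA.
  have h3 := @adjoint_hom0 (fquot F J K) (fquot F J M) _ _ A' X (i_right_adj r).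
  by split=> [/h2/h3/h1|/h1/h3/h2].
have notJ s : ~~ (s <= K) -> ~~ (s <= J).
  by apply: contra => sJ; exact: (le_trans sJ JK).
split=> X /=; split.
- move=> leX; split=> s B sM sJ geB; first exact: leX (notJ _ sJ) geB.
  by apply/(leK X _ _ sM sJ geB); apply: leX geB => //; exact: (le_trans sM KM).
- move=> [leX leX'] s B sM sJ geB; have [sK|sK] := boolP (s <= K).
    by apply/(leK X _ _ sK sJ geB); apply: leX' geB.
  exact: leX geB.
- move=> geX; split=> s A sM sJ leA; first exact: geX (notJ _ sJ) leA.
  by apply/(geK X _ _ sM sJ leA); apply: geX leA => //; exact: (le_trans sM KM).
- move=> [geX geX'] s A sM sJ leA; have [sK|sK] := boolP (s <= K).
    by apply/(geK X _ _ sK sJ leA); apply: geX' leA.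
  exact: geX leA.
Qed.

Lemma fquot_recollement J K M (JK : J <= K) (KM : K <= M) :
  exists r : recollement (fquot_incl J (rfil_mono (proj2 hF) KM))
                         (fquot_quot M (rfil_mono (proj2 hF) JK)), True.
Proof.
exact: verdier_recollement (rfil_mono (proj2 hF) JK) _ (fil_ladm hF J)
  (fil_radm hF J) (fil_ladm hF K) (fil_radm hF K) _ _.
Qed.

(** * Uniqueness of a glued system *)

Section Uniqueness.
Variable t : forall J M, J <= M -> t_structure (fquot F J M).
Hypothesis t_stratum : forall s (hs : join_prime s),
  t (join_lt_le s) = tau hs.
Hypothesis t_glued : forall J K M (JK : J <= K) (KM : K <= M),
  exists r : recollement (fquot_incl J (rfil_mono (proj2 hF) KM))
                         (fquot_quot M (rfil_mono (proj2 hF) JK)),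
    glued r (t JK) (t KM) (t (le_trans JK KM)).

Lemma t_irr J M (h h' : J <= M) : t h = t h'.
Proof. by rewrite (bool_irrelevance h h'). Qed.

(** The quotient functor kills the image of X, and maps from its [i_left] to the coaisle are, by
    adjunction and full faithfulness, maps from X. The coaisle is dual, with [i_right]. *)
Lemma t_incl J K M (JK : J <= K) (KM : K <= M) (JM : J <= M) (X : fquot F J K) :
  let iX := fquot_incl J (rfil_mono (proj2 hF) KM) X in
  (le0 (t JK) X -> le0 (t JM) iX) /\ (ge1 (t JK) X -> ge1 (t JM) iX).
Proof.
move=> iX; have [r [leM geM]] := t_glued JK KM.
rewrite (t_irr JM (le_trans JK KM)).
have KX : restr (F M) (F K) iX by apply: svalP X.
split=> [leX|geX].
  apply/leM; split.
    apply/(le0P (fquot_left hF KM)) => B _.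
    exact: (verdier_zero_hom0 (fquot_right hF KM)).
  apply/(le0P (fquot_left hF JK)) => B geB.
  apply: (proj2 (adjoint_hom0 _ _ (i_left_adj r))).
  by apply: (ff_hom0 (i_ff r)); apply: t_hom0 leX geB.
apply/geM; split.
  apply/(ge1P (fquot_left hF KM) (fquot_right hF KM)) => A _.
  exact: (verdier_hom0_zero (fquot_left hF KM)).
apply/(ge1P (fquot_left hF JK) (fquot_right hF JK)) => A leA.
apply: (proj1 (adjoint_hom0 _ _ (i_right_adj r))).
by apply: (ff_hom0 (i_ff r)); apply: t_hom0 leA geX.
Qed.

Lemma t_quot J K M (JK : J <= K) (KM : K <= M) (JM : J <= M) (X : sub (F M)) :
  (le0 (t JM) X -> le0 (t KM) X) /\ (ge1 (t JM) X -> ge1 (t KM) X).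
Proof.
have [r [leM geM]] := t_glued JK KM.
rewrite (t_irr JM (le_trans JK KM)).
by split=> [/leM[]|/geM[]].
Qed.

(** From the stratum, gluing gives the claim on [F s] modulo the meet of J and s, since [i_left] of
    X has no maps to the lower part. It then passes to [F M] by [t_incl] and to the quotient by
    [F J] by [t_quot]. *)
Lemma stratum_le_t s J M (JM : J <= M) (X : sub (F M)) :
  s <= M -> ~~ (s <= J) -> sle s (sval X) -> le0 (t JM) X.
Proof.
move=> sM sJ [hs [hX [leX Xo]]].
have Is : J `&` s <= s by apply: leIr.
have Il := meet_le_join_lt sJ.
pose X1 : fquot F (J `&` s) s := exist _ (sval X) hX.
have leX1 : le0 (t Is) X1.
  have [r [leM _]] := t_glued Il (join_lt_le s).
  rewrite (t_irr Is (le_trans Il (join_lt_le s))).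
  apply/leM; split; first by rewrite (t_stratum hs).
  apply/(le0P (fquot_left hF Il)) => B _.
  apply: (proj2 (adjoint_hom0 _ _ (i_left_adj r))).
  have X1o : left_orth (restr (F s) (F (J `&` s))) X1.
    exact/(left_orth_restr (mono Is))/(left_orth_le (mono Il)).
  apply/(verdier_hom0_left _ X1o)/Xo; exact: svalP B.
have IM : J `&` s <= M := le_trans Is sM.
have := proj1 (t_incl Is sM IM X1) leX1.
(* The two objects differ only in their proofs of membership in [F M]. *)
move/(proj1 (t_quot (leIl J s) JM IM _)); apply: le0_iso.
by apply: verdier_isoT; exists (idm (sval X)); apply: (is_iso_id (sval X)).
Qed.

Lemma stratum_ge_t s J M (JM : J <= M) (X : sub (F M)) :
  s <= M -> ~~ (s <= J) -> sge s (sval X) -> ge1 (t JM) X.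
Proof.
move=> sM sJ [hs [hX [geX Xo]]].
have Is : J `&` s <= s by apply: leIr.
have Il := meet_le_join_lt sJ.
pose X1 : fquot F (J `&` s) s := exist _ (sval X) hX.
have geX1 : ge1 (t Is) X1.
  have [r [_ geM]] := t_glued Il (join_lt_le s).
  rewrite (t_irr Is (le_trans Il (join_lt_le s))).
  apply/geM; split; first by rewrite (t_stratum hs).
  apply/(ge1P (fquot_left hF Il) (fquot_right hF Il)) => A _.
  apply: (proj1 (adjoint_hom0 _ _ (i_right_adj r))).
  have X1o : right_orth (restr (F s) (F (J `&` s))) X1.
    exact/(right_orth_restr (mono Is))/(right_orth_le (mono Il)).
  apply/(verdier_hom0_right _ X1o)/Xo; exact: svalP A.
have IM : J `&` s <= M := le_trans Is sM.
have := proj2 (t_incl Is sM IM X1) geX1.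
move/(proj2 (t_quot (leIl J s) JM IM _)); apply: ge1_iso.
by apply: verdier_isoT; exists (idm (sval X)); apply: (is_iso_id (sval X)).
Qed.

(** Testing against strata puts the aisle and coaisle of [t] inside those of [interval_t]. Each is
    the orthogonal of the other, so inclusion on one side gives the reverse inclusion on the
    other. *)
Lemma interval_t_unique J M (JM : J <= M) : interval_t JM = t JM.
Proof.
have le_sub X : le0 (t JM) X -> interval_le J X.
  move=> leX s B sM sJ geB; have MB := mono sM (stratum_ge_in geB).
  pose B' : sub (F M) := exist _ B MB.
  apply: (proj1 (interval_hom0_ge JM X (Y := B') sJ geB)).
  exact: t_hom0 leX (stratum_ge_t JM (X := B') sM sJ geB).
have ge_sub X : ge1 (t JM) X -> interval_ge J X.
  move=> geX s A sM sJ leA; have MA := mono sM (stratum_le_in leA).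
  pose A' : sub (F M) := exist _ A MA.
  apply: (proj1 (interval_hom0_le JM X (X := A') sJ leA)).
  exact: t_hom0 (stratum_le_t JM (X := A') sM sJ leA) geX.
apply: t_structure_ext => X; split.
- move=> leX; apply/(le0P (fquot_left hF JM)) => B /ge_sub.
  exact: (interval_hom0 JM).
- exact: le_sub.
- move=> geX.
  apply/(ge1P (fquot_left hF JM) (fquot_right hF JM)) => A /le_sub leA.
  exact: (interval_hom0 JM).
- exact: ge_sub.
Qed.

End Uniqueness.
End IntervalTStructures.

Theorem theorem1p7 (disp : Order.disp_t) (L : finTBDistrLatticeType disp)
    (D : tricat) (F : L -> subcat D) (hF : admissible_filtration F)
    (hstrict : strict_filtration F)
    (tau : forall s : L, join_prime s -> t_structure (fquot F (join_lt s) s)) :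
  exists! t : forall J M : L, J <= M -> t_structure (fquot F J M),
    (forall (s : L) (hs : join_prime s),
        t (join_lt s) s (join_lt_le s) = tau s hs) /\
    (forall (J K M : L) (hJK : J <= K) (hKM : K <= M),
        exists r : recollement (fquot_incl J (rfil_mono (proj2 hF) hKM))
                               (fquot_quot M (rfil_mono (proj2 hF) hJK)),
          glued r (t J K hJK) (t K M hKM) (t J M (le_trans hJK hKM))).
Proof.
exists (fun J M JM => interval_t hF hstrict tau JM); split.
  split=> [s hs|J K M JK KM]; first exact: interval_t_stratum.
  have [r _] := fquot_recollement hF JK KM.
  by exists r; apply: interval_t_glued.
move=> t [t_stratum t_glued].
apply/functional_extensionality_dep => J.
apply/functional_extensionality_dep => M.
apply/functional_extensionality_dep => JM.
exact: interval_t_unique.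
Qed.
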